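(* Let $(Y^n)_{n\ge 1}$ be a sequence of centred Gaussian vectors $Y^n=(Y^{(n)}_1,\dots,Y^{(n)}_n)$ such that for every $n\ge 1$ the elements $Y^{(n)}_k$, $k=1,\dots,n$, belong to the first Wiener chaos. Let $\Gamma^{(n)}$ be the covariance matrix of $Y^n$, with eigenvalues $\lambda^n_1,\dots,\lambda^n_n$, and let $$V_n=\sum_{k=1}^n\left[(Y^{(n)}_k)^2-\mathbb{E}(Y^{(n)}_k)^2\right].$$ Then, as $n\to\infty$, the following are equivalent: (1) $\dfrac{V_n}{\sqrt{\mathrm{Var}(V_n)}}\to\mathcal{N}(0,1)$ in distribution; (2) $\displaystyle\sum_{i,j,k,l=1}^n\mathbb{E}[Y^{(n)}_kY^{(n)}_j]\,\mathbb{E}[Y^{(n)}_jY^{(n)}_i]\,\mathbb{E}[Y^{(n)}_iY^{(n)}_l]\,\mathbb{E}[Y^{(n)}_lY^{(n)}_k]=o\left(\mathrm{Var}(V_n)^2\right)$; (3) $\displaystyle\sum_{k=1}^n(\lambda^n_k)^4=o\left(\Big[\sum_{k=1}^n(\lambda^n_k)^2\Big]^2\right)$.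
   Context: The first Wiener chaos of a separable centred Gaussian process $X$ is the closed linear subspace of $L^2(\Omega)$ spanned by the random variables of $X$; all its elements are centred and jointly Gaussian. $\Gamma^{(n)}_{jk}=\mathbb{E}[Y^{(n)}_jY^{(n)}_k]$. $a_n=o(b_n)$ means $|a_n|/|b_n|\to0$. It is understood that $\mathrm{Var}(V_n)>0$, so that the normalised variable is defined. *)

(* Defs.v *)
From HB Require Import structures.
From mathcomp Require Import all_boot all_order all_algebra.
From mathcomp Require Import all_classical all_reals all_analysis.
From mathcomp Require Import measurable_realfun.

Set Implicit Arguments.
Unset Strict Implicit.
Unset Printing Implicit Defensive.

Import Order.TTheory GRing.Theory Num.Theory.
Import numFieldNormedType.Exports.

Local Open Scope classical_set_scope.
Local Open Scope ring_scope.

(* [Z] has law N(m, s^2).  [normal_prob m 0] is the uniform law on [0, 1], so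
   the degenerate Gaussian law has to be spelled out as a Dirac mass. *)
Definition gaussian_rv (d : measure_display) (T : measurableType d)
    (R : realType) (P : probability T R) (Z : {RV P >-> R}) : Prop :=
  exists m s : R, forall A : set R, measurable A ->
    distribution P Z A = if s == 0 then \d_m A else normal_prob m s A.

Definition lin_span (d : measure_display) (T : measurableType d)
    (R : realType) (P : probability T R) (I : Type) (X : I -> {RV P >-> R}) :
    set {RV P >-> R} :=
  [set Z | exists (m : nat) (a : 'I_m -> R) (t : 'I_m -> I),
    Z = \sum_(i < m) a i *: X (t i)].

(* [X] is a centred Gaussian process indexed by [I] (a centred Gaussian vector
   when [I] is finite). *)
Definition centred_gaussian (d : measure_display) (T : measurableType d)
    (R : realType) (P : probability T R) (I : Type)
    (X : I -> {RV P >-> R}) : Prop :=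
  (forall Z, lin_span X Z -> gaussian_rv Z) /\ (forall i, ('E_P[X i] = 0)%E).

(* The closure of the linear span of [X] in L^2.  Elements are represented by
   random variables rather than by classes modulo almost sure equality; any
   [Z] satisfying the condition is automatically square integrable when the
   [X i] are. *)
Definition first_chaos (d : measure_display) (T : measurableType d)
    (R : realType) (P : probability T R) (I : Type) (X : I -> {RV P >-> R}) :
    set {RV P >-> R} :=
  [set Z | forall e : R, 0 < e -> exists W, lin_span X W /\
    ('N[P]_2%:E[EFin \o (Z \- W)%R] < e%:E)%E].

(* Separability of [X] is that of the Hilbert space it spans in L^2. *)
Definition separable_process (d : measure_display) (T : measurableType d)
    (R : realType) (P : probability T R) (I : Type)
    (X : I -> {RV P >-> R}) : Prop :=
  exists D : nat -> {RV P >-> R}, (forall m, first_chaos X (D m)) /\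
    forall Z, first_chaos X Z -> forall e : R, 0 < e ->
      exists m, ('N[P]_2%:E[EFin \o (Z \- D m)%R] < e%:E)%E.

Definition cvg_in_distribution (d : measure_display) (T : measurableType d)
    (R : realType) (P : probability T R) (Z : nat -> {RV P >-> R})
    (mu : probability (measurableTypeR R) R) : Prop :=
  forall f : R -> R, continuous f -> bounded_fun (f : R -> R^o) ->
    ('E_P[f \o Z n] @[n --> \oo] --> \int[mu]_x (f x)%:E)%E.

Definition is_littleo (R : realType) (a b : nat -> R) : Prop :=
  `|a n| / `|b n| @[n --> \oo] --> (0 : R).

Definition cov_matrix (d : measure_display) (T : measurableType d)
    (R : realType) (P : probability T R) (n : nat) (Y : 'I_n -> {RV P >-> R}) :
    'M[R]_n :=
  \matrix_(j, k) fine 'E_P[Y j \* Y k]%E.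

(* The eigenvalues of [A], repeated according to algebraic multiplicity. *)
Definition eigenvalues (R : realType) (n : nat) (A : 'M[R]_n)
    (l : 'I_n -> R) : Prop :=
  char_poly A = \prod_(k < n) ('X - (l k)%:P).

Definition quad_var (d : measure_display) (T : measurableType d)
    (R : realType) (P : probability T R) (n : nat) (Y : 'I_n -> {RV P >-> R}) :
    {RV P >-> R} :=
  \sum_(k < n) (Y k ^+ 2 - cst (fine 'E_P[(Y k : T -> R) ^+ 2]%E)).

Definition normalised (d : measure_display) (T : measurableType d)
    (R : realType) (P : probability T R) (Z : {RV P >-> R}) : {RV P >-> R} :=
  (Num.sqrt (fine 'V_P[Z]%E))^-1 *: Z.

(* Main.v *)
Require Import Defs.
From HB Require Import structures.
From mathcomp Require Import all_boot all_order all_algebra.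
From mathcomp Require Import all_classical all_reals all_analysis.
From mathcomp Require Import measurable_realfun.
From mathcomp Require Import ring lra.

Set Implicit Arguments.
Unset Strict Implicit.
Unset Printing Implicit Defensive.

Import Order.TTheory GRing.Theory Num.Theory.
Import numFieldNormedType.Exports.

Local Open Scope classical_set_scope.
Local Open Scope ring_scope.


(** Write [S] for the sum of the squares of a centred Gaussian vector with
    covariance eigenvalues [lam k], [sigma ^+ 2 = 2 * sum_k lam k ^+ 2],
    [mu k = lam k / sigma] and [W = (S - sum_k lam k) / sigma], so that
    [sum_k mu k ^+ 2 = 1 / 2].  An orthogonal change of coordinates makes [S] a
    sum of squares of uncorrelated Gaussian variables with variances [lam k].
    The sum in the second condition is then the trace of the fourth power of
    the covariance matrix, that is [sum_k lam k ^+ 4], and the variance of [S]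
    is [sigma ^+ 2] ([gamma_variance]).  Hence the second and the third
    condition both say that [sum_k mu k ^+ 4] tends to zero, and it remains to
    see that this is equivalent to the central limit theorem for [W].

    Everything rests on the Laplace transform
    [E expR (- t S) = prod_k (1 + 2 t lam k)^(-1/2)].  To obtain it from the
    hypothesis on linear combinations, each [expR (- t z ^+ 2)] is written as
    the mean of [cos (sqrt (2 t) x z)] over an auxiliary standard Gaussian [x]
    ([gaussian_linearisation]): cosines of linear combinations of a Gaussian
    vector have known means.

    If [sum_k mu k ^+ 4] tends to zero, Stein's method applies.  Differentiating
    the logarithm of the Laplace transform gives, for exponential functions [F],
    the identity
    [E ((S - E S) F(S)) = sum_k 2 lam_k^2 E (F' (S + lam_k chi))],
    with [chi] an independent chi-square variable with two degrees of freedom.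
    Bernstein polynomials in [expR (- S)] extend it to every [F] with bounded
    continuous derivative ([gamma_zero_bias]).  After standardisation the
    weights [2 * mu k ^+ 2] add up to one, so that [E (f' (W) - W f(W))] is an
    average of increments of [f'] over shifts [mu k * chi]; when [f] solves
    Stein's equation for a bounded continuous [h] ([stein_solution]), it is
    also the difference between [E h(W)] and the Gaussian mean of [h]
    ([stein_bound]).

    Conversely, the inequality [ln (1 + y) >= y - y^2 / 2 + y^3 / 9] on [[0, 2]]
    gives [E expR (- W) <= expR (1 / 2 - 4 / 9 * sum_k mu k ^+ 4)]
    ([standardised_laplace]).  Under convergence in law the lower limit of the
    left-hand side is at least the Gaussian value [expR (1 / 2)], which forces
    [sum_k mu k ^+ 4] to vanish ([clt_to_fourth]). *)

(** * Orthogonal diagonalisation of a real symmetric matrix *)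

(** The Householder reflection exchanging [v] and the first basis vector. *)
Lemma orthogonal_first_row (R : realType) n (v : 'rV[R]_(1 + n)) :
  v *m v^T = 1%:M ->
  exists H : 'M[R]_(1 + n), H *m H^T = 1%:M /\ row 0 H = v.
Proof.
move=> vv; pose e : 'rV[R]_(1 + n) := delta_mx 0 0.
have [veq|vne] := eqVneq v e.
  exists 1%:M; split; first by rewrite trmx1 mulmx1.
  by rewrite veq rowE mulmx1.
have [w wE] : exists w, w = v - e by exists (v - e).
pose c := (w *m w^T) 0 0.
have ee : e *m e^T = 1%:M.
  by rewrite trmx_delta mul_delta_mx; apply/matrixP => i j; rewrite !ord1 !mxE.
have ve : v *m e^T = (v 0 0)%:M.
  by rewrite trmx_delta -colE; apply/matrixP => i j; rewrite !ord1 !mxE.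
have ev : e *m v^T = (v 0 0)%:M.
  by rewrite -rowE; apply/matrixP => i j; rewrite !ord1 !mxE.
have wwE : w *m w^T = (2 - 2 * v 0 0)%:M.
  rewrite wE linearB/= mulmxBl !mulmxBr vv ee ve ev.
  by apply/matrixP => i j; rewrite !ord1 !mxE/= !mulr1n; ring.
have ewE : e *m w^T = (v 0 0 - 1)%:M.
  rewrite wE linearB/= !mulmxBr ee ev.
  by apply/matrixP => i j; rewrite !ord1 !mxE/= !mulr1n; ring.
have cE : c = 2 - 2 * v 0 0 by rewrite /c wwE mxE/= mulr1n.
have c0 : c != 0.
  apply: contra_neq vne => c0; apply/eqP; rewrite -subr_eq0; apply/eqP.
  apply/rowP => j; rewrite -wE [RHS]mxE; apply/eqP; rewrite -sqrf_eq0.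
  have : \sum_k w 0 k ^+ 2 = 0.
    by apply: etrans c0; rewrite /c mxE; apply: eq_bigr => k _; rewrite [w^T _ _]mxE expr2.
  move/eqP; rewrite psumr_eq0; last by move=> k _; exact: sqr_ge0.
  by move/allP => /(_ j); rewrite mem_index_enum => /(_ isT).
exists (1%:M - (2 / c) *: (w^T *m w)); split.
  have TS : (1%:M - (2 / c) *: (w^T *m w))^T = 1%:M - (2 / c) *: (w^T *m w).
    apply/matrixP => i j; rewrite !mxE eq_sym; congr (_ - _ * _).
    by apply: eq_bigr => k _; rewrite !mxE mulrC.
  rewrite TS.
  rewrite mulmxBl mul1mx mulmxBr mulmx1 -scalemxAl -scalemxAr.
  rewrite mulmxA -(mulmxA w^T w) wwE -cE mul_mx_scalar -scalemxAl.
  rewrite !scalerA opprB -scalerBl -scaleNr -addrA -scalerDl.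
  rewrite [X in X *: _](_ : _ = 0) ?scale0r ?addr0//.
  by field.
rewrite rowE mulmxBr mulmx1 -scalemxAr mulmxA -/e ewE mul_scalar_mx scalerA.
rewrite [X in X *: _](_ : _ = -1) ?scaleN1r ?opprK; first by rewrite wE addrC subrK.
by rewrite cE; field; rewrite -cE.
Qed.

Lemma char_poly_conj (R : realType) n (H A : 'M[R]_n) :
  H *m H^T = 1%:M -> char_poly (H *m A *m H^T) = char_poly A.
Proof.
move=> HH; rewrite /char_poly /char_poly_mx.
have HHp : map_mx polyC H *m map_mx polyC H^T = 1%:M :> 'M[{poly R}]_n.
  by rewrite -map_mxM HH map_mx1.
have -> : 'X%:M - map_mx polyC (H *m A *m H^T)
  = map_mx polyC H *m ('X%:M - map_mx polyC A) *m map_mx polyC H^T.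
  rewrite mulmxBr mulmxBl !map_mxM; congr (_ - _).
  by rewrite mul_mx_scalar -scalemxAl HHp scalemx1.
by rewrite !det_mulmx mulrAC -det_mulmx HHp det1 mul1r.
Qed.

(** Induction on the size: conjugating by an orthogonal matrix whose first row
    is a unit eigenvector for [l 0] splits off the block [l 0], and cancelling
    one linear factor leaves the induction hypothesis for the other block.
    The splitting of the characteristic polynomial provides the eigenvectors
    and fixes the order of the eigenvalues. *)
Lemma symmetric_diagonalisation (R : realType) n (A : 'M[R]_n) (l : 'I_n -> R) :
  A^T = A -> char_poly A = \prod_(k < n) ('X - (l k)%:P) ->
  exists O : 'M[R]_n, O *m O^T = 1%:M /\ O *m A *m O^T = diag_mx (\row_k l k).
Proof.
elim: n A l => [|n IH] A l Asym Achar.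
  by exists 1%:M; split; apply/matrixP => -[].
have /eigenvalueP[u uA u0] : eigenvalue A (l 0).
  rewrite eigenvalue_root_char Achar /root horner_prod prodf_seq_eq0.
  by apply/hasP; exists 0; rewrite ?mem_index_enum// hornerXsubC subrr eqxx.
pose c := \sum_k u 0 k ^+ 2.
have uu : u *m u^T = c%:M.
  apply/matrixP => i j; rewrite !ord1 !mxE/= mulr1n.
  by apply: eq_bigr => k _; rewrite mxE expr2.
have c_gt0 : 0 < c.
  rewrite lt_neqAle sumr_ge0 ?andbT; last by move=> k _; exact: sqr_ge0.
  apply: contra_neq u0 => /esym/eqP; rewrite psumr_eq0; last first.
    by move=> k _; exact: sqr_ge0.
  move=> /allP h; apply/rowP => j; have := h j.
  by rewrite mem_index_enum sqrf_eq0 mxE => /(_ isT)/eqP.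
pose v : 'rV[R]_(1 + n) := (Num.sqrt c)^-1 *: u.
have vA : v *m A = l 0 *: v.
  by rewrite /v -scalemxAl uA !scalerA mulrC.
have vv : v *m v^T = 1%:M.
  rewrite /v linearZ/= -scalemxAl -scalemxAr scalerA uu -expr2 exprVn sqr_sqrtr ?ltW//.
  by rewrite scale_scalar_mx mulVf ?gt_eqF.
have [H [HH Hv]] := orthogonal_first_row vv.
have [B BE] : exists B : 'M[R]_(1 + n), B = H *m A *m H^T by eexists.
have Bsym : B^T = B by rewrite BE !trmx_mul trmxK Asym mulmxA.
have B0 : row 0 B = l 0 *: delta_mx 0 0.
  rewrite rowE BE !mulmxA -rowE Hv vA -scalemxAl -Hv rowE.
  by rewrite -mulmxA HH mulmx1.
pose A' := drsubmx B.
have Bblock : B = block_mx (l 0)%:M 0 0 A'.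
  rewrite -[LHS]submxK; congr block_mx.
  - apply/matrixP => i j; rewrite !ord1 !mxE/=.
    have := congr1 (fun M : 'rV__ => M 0 0) B0; rewrite !mxE/= mulr1 mulr1n => <-.
    by congr (B _ _); apply/val_inj.
  - apply/matrixP => i j; rewrite !ord1 !mxE/=.
    have := congr1 (fun M : 'rV__ => M 0 (rshift 1 j)) B0.
    rewrite !mxE/= mulr0 => <-.
    by congr (B _ _); apply/val_inj.
  - apply/matrixP => i j; rewrite !ord1 !mxE/=.
    have := congr1 (fun M : 'rV__ => M 0 (rshift 1 i)) B0.
    rewrite !mxE/= mulr0 -[in LHS]Bsym mxE => <-.
    by congr (B _ _); apply/val_inj.
have A'sym : A'^T = A' by apply/matrixP => i j; rewrite !mxE -[in LHS]Bsym mxE.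
have A'char : char_poly A' = \prod_(k < n) ('X - (l (lift 0 k))%:P).
  have : char_poly B = ('X - (l 0)%:P) * char_poly A'.
    rewrite Bblock /char_poly /char_poly_mx map_block_mx !map_mx0.
    rewrite scalar_mx_block opp_block_mx add_block_mx !subr0 det_ublock.
    congr (_ * _); rewrite map_scalar_mx -raddfB/=.
    by rewrite det_scalar expr1.
  rewrite BE char_poly_conj// Achar big_ord_recl => /mulfI -> //.
  by rewrite polyXsubC_eq0.
have [U [UU UA]] := IH A' (fun k => l (lift 0 k)) A'sym A'char.
pose L : 'M[R]_(1 + n) := block_mx 1%:M 0 0 U.
have LT : L^T = block_mx 1%:M 0 0 U^T.
  by rewrite /L (@tr_block_mx _ 1 n 1 n) trmx1 !trmx0.
exists (L *m H); split.
  rewrite trmx_mul mulmxA -(mulmxA L) HH mulmx1 LT /L.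
  rewrite (@mulmx_block _ 1 n 1 n 1 n) !mulmx0 !mul0mx !addr0 add0r UU mulmx1.
  by rewrite -scalar_mx_block.
have -> : L *m H *m A *m (L *m H)^T = L *m B *m L^T.
  by rewrite trmx_mul BE !mulmxA.
rewrite LT /L Bblock !(@mulmx_block _ 1 n 1 n 1 n).
rewrite !mulmx0 !mul0mx !addr0 !add0r mulmx1 mul1mx UA ?mulmx0 ?mul0mx.
have -> : \row_k l k = row_mx (const_mx (l 0)) (\row_k l (lift 0 k)) :> 'rV_(1 + n).
  apply/rowP => j; rewrite mxE; case: (splitP j) => k jk.
    rewrite (_ : j = lshift n k); last exact/val_inj.
    by rewrite row_mxEl mxE; congr l; apply/val_inj; rewrite /= ord1.
  rewrite (_ : j = rshift 1 k); last exact/val_inj.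
  by rewrite row_mxEr mxE; congr l; apply/val_inj.
by rewrite [RHS](@diag_mx_row _ n 1) diag_const_mx.
Qed.

Lemma mxtrace_square_entries (R : realType) n (A : 'M[R]_n) :
  \tr (A *m A) = \sum_(i < n) \sum_(j < n) A i j * A j i.
Proof. by apply: eq_bigr => i _; rewrite mxE. Qed.

(** The left-hand side is the cyclic sum in the fourth-cumulant condition. *)
Lemma mxtrace_fourth_entries (R : realType) n (A : 'M[R]_n) :
  \sum_(i < n) \sum_(j < n) \sum_(k < n) \sum_(l < n)
    A k j * A j i * A i l * A l k = \tr (A *m A *m (A *m A)).
Proof.
transitivity (\sum_i \sum_k (A *m A) i k * (A *m A) k i).
  apply: eq_bigr => i _; rewrite exchange_big; apply: eq_bigr => k _.
  rewrite 2!mxE mulr_sumr; apply: eq_bigr => j _.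
  rewrite mulr_suml; apply: eq_bigr => l _.
  by ring.
by rewrite -mxtrace_square_entries.
Qed.

Lemma mxtrace_diagonalised (R : realType) n (A U : 'M[R]_n) (l : 'I_n -> R) :
  U *m U^T = 1%:M -> U *m A *m U^T = diag_mx (\row_k l k) ->
  [/\ \tr A = \sum_(k < n) l k, \tr (A *m A) = \sum_(k < n) l k ^+ 2 &
      \tr (A *m A *m (A *m A)) = \sum_(k < n) l k ^+ 4].
Proof.
move=> UU UA; have UTU : U^T *m U = 1%:M by exact: mulmx1C.
have conjM M N : U *m (M *m N) *m U^T = (U *m M *m U^T) *m (U *m N *m U^T).
  by rewrite !mulmxA -(mulmxA (U *m M) U^T) UTU mulmx1.
have trE M : \tr M = \tr (U *m M *m U^T).
  by rewrite mxtrace_mulC mulmxA UTU mul1mx.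
by split; rewrite trE ?conjM UA ?mulmx_diag mxtrace_diag;
  apply: eq_bigr => k _; rewrite !mxE; ring.
Qed.

(** * Real-valued integration *)

Section integration_helpers.
Context d (T : measurableType d) (R : realType).

Lemma integrable_le (mu : {measure set T -> \bar R}) (f g : T -> R) :
  measurable_fun setT f -> mu.-integrable setT (EFin \o g) ->
  (forall x, `|f x| <= g x) -> mu.-integrable setT (EFin \o f).
Proof.
move=> mf ig fg; apply: le_integrable ig => //.
  exact/measurable_EFinP.
by move=> x _ /=; rewrite lee_fin (le_trans (fg x))// ler_norm.
Qed.

Lemma integrable_bounded (P : probability T R) (f : T -> R) (C : R) :
  measurable_fun setT f -> (forall x, `|f x| <= C) ->
  P.-integrable setT (EFin \o f).
Proof.
move=> mf fC; apply: (@integrable_le _ _ (cst C)) => //.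
exact: finite_measure_integrable_cst.
Qed.

Lemma Rintegral_prob_cst (P : probability T R) (r : R) : \int[P]_x r = r.
Proof.
rewrite Rintegral_cst// (_ : Measure.sort P _ = 1%E) ?mulr1//.
exact: probability_setT.
Qed.

Lemma integrableZ_EFin (mu : {measure set T -> \bar R}) (k : R) (f : T -> R) :
  mu.-integrable setT (EFin \o f) ->
  mu.-integrable setT (EFin \o (fun x => k * f x)).
Proof.
move=> intf; rewrite (_ : EFin \o _ = (fun x => k%:E * (EFin \o f) x)%E) //.
exact: integrableZl.
Qed.

Lemma integrableD_EFin (mu : {measure set T -> \bar R}) (f g : T -> R) :
  mu.-integrable setT (EFin \o f) -> mu.-integrable setT (EFin \o g) ->
  mu.-integrable setT (EFin \o (fun x => f x + g x)).
Proof.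
move=> intf intg.
by rewrite (_ : EFin \o _ = ((EFin \o f) \+ (EFin \o g))%E) //; exact: integrableD.
Qed.

Lemma integrableB_EFin (mu : {measure set T -> \bar R}) (f g : T -> R) :
  mu.-integrable setT (EFin \o f) -> mu.-integrable setT (EFin \o g) ->
  mu.-integrable setT (EFin \o (fun x => f x - g x)).
Proof.
move=> intf intg.
by rewrite (_ : EFin \o _ = ((EFin \o f) \- (EFin \o g))%E) //; exact: integrableB.
Qed.

Lemma integrable_sum_EFin (P : probability T R) (I : Type) (s : seq I) (F : I -> T -> R) :
  (forall i, P.-integrable setT (EFin \o F i)) ->
  P.-integrable setT (EFin \o (fun w => \sum_(i <- s) F i w)) /\
  \int[P]_w (\sum_(i <- s) F i w) = \sum_(i <- s) \int[P]_w F i w.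
Proof.
move=> iF; elim: s => [|i s [ifs IH]].
  split; last by under eq_Rintegral do rewrite big_nil; rewrite Rintegral_prob_cst big_nil.
  by under eq_fun do rewrite big_nil; exact: finite_measure_integrable_cst.
split; first by under eq_fun do rewrite big_cons; exact: integrableD_EFin.
under eq_Rintegral do rewrite big_cons.
by rewrite RintegralD// IH big_cons.
Qed.

Lemma Rdominated_cvg (mu : {measure set T -> \bar R}) (f_ : nat -> T -> R)
    (f g : T -> R) :
  (forall n, measurable_fun setT (f_ n)) ->
  (forall x, f_ n x @[n --> \oo] --> f x) ->
  mu.-integrable setT (EFin \o g) ->
  (forall n x, `|f_ n x| <= g x) ->
  \int[mu]_x f_ n x @[n --> \oo] --> \int[mu]_x f x.
Proof.
move=> mf_ f_f ig fg; rewrite /Rintegral.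
have mf : measurable_fun setT f.
  by apply: (@measurable_fun_cvg _ _ _ _ f_) => // x _; exact: f_f.
have fgl x : `|f x| <= g x.
  have nf : `|f_ n x| @[n --> \oo] --> `|f x| by apply: cvg_norm; exact: f_f.
  by apply: (cvgr_to_le nf); apply: nearW.
apply: fine_cvg; rewrite fineK; last first.
  apply: integrable_fin_num => //; exact: (@integrable_le _ _ g).
apply: (@dominated_cvg _ _ _ mu setT measurableT _ _ (EFin \o g)) => //.
- by move=> n; exact/measurable_EFinP.
- by move=> x _; apply: cvg_EFin; [exact: nearW|exact: f_f].
- by move=> n x _ /=; rewrite lee_fin.
Qed.

End integration_helpers.

Section bounded_fubini.
Context d1 d2 (T1 : measurableType d1) (T2 : measurableType d2) (R : realType).
Variables (P : probability T1 R) (Q : probability T2 R).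
Variables (F : T1 * T2 -> R) (C : R).
Hypotheses (mF : measurable_fun setT F) (FC : forall z, `|F z| <= C).

Let iF : (P \x Q)%E.-integrable setT (EFin \o F).
Proof. exact: (@integrable_bounded _ _ _ (P \x Q)%E _ C). Qed.

Let section1 x : (\int[Q]_y (F (x, y))%:E)%E = (\int[Q]_y F (x, y))%:E.
Proof.
rewrite fineK//; apply: integrable_fin_num => //.
apply: (@integrable_bounded _ _ _ Q _ C) => //.
exact: (measurableT_comp mF (pair1_measurable x)).
Qed.

Let section2 y : (\int[P]_x (F (x, y))%:E)%E = (\int[P]_x F (x, y))%:E.
Proof.
rewrite fineK//; apply: integrable_fin_num => //.
apply: (@integrable_bounded _ _ _ P _ C) => //.
exact: (measurableT_comp mF (pair2_measurable y)).
Qed.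

Lemma Rfubini_prod : \int[(P \x Q)%E]_z F z = \int[P]_x \int[Q]_y F (x, y).
Proof.
rewrite /Rintegral -(integral12_prod_meas1 iF) /fubini_F; congr fine.
by apply: eq_integral => x _; rewrite section1.
Qed.

Lemma Rfubini : \int[P]_x \int[Q]_y F (x, y) = \int[Q]_y \int[P]_x F (x, y).
Proof.
rewrite /Rintegral; congr fine.
under eq_integral do rewrite -section1.
under [RHS]eq_integral do rewrite -section2.
exact: (Fubini iF).
Qed.

Lemma integrable_section :
  P.-integrable setT (EFin \o (fun x => \int[Q]_y F (x, y))).
Proof.
rewrite (_ : EFin \o _ = fubini_F Q (EFin \o F)); first exact: integrable_fubini_F.
by apply/funext => x; rewrite /fubini_F /= section1.
Qed.

End bounded_fubini.

(** * One-dimensional Gaussian integrals *)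

Section normal_integrals.
Context (R : realType).
Implicit Types m s : R.
Local Notation mu := (@lebesgue_measure R).

Lemma ge0_integral_normal_prob m s (f : R -> \bar R) :
  measurable_fun setT f -> (forall x, 0 <= f x)%E ->
  (\int[normal_prob m s]_x f x = \int[mu]_x (f x * (normal_pdf m s x)%:E))%E.
Proof.
move=> mf f0; have dom := normal_prob_dominates m s.
rewrite -(Radon_Nikodym_SigmaFinite.change_of_variables dom)//.
apply: ae_eq_integral => //.
- apply: emeasurable_funM => //; apply: (measurable_int mu).
  exact: Radon_Nikodym_SigmaFinite.f_integrable.
- apply: emeasurable_funM => //; apply/measurable_EFinP.
  exact: measurable_normal_pdf.
apply: ae_eqe_mul2l; apply: integral_ae_eq => //.
- exact: Radon_Nikodym_SigmaFinite.f_integrable.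
- by apply/measurable_EFinP; exact: measurable_normal_pdf.
by move=> E _ mE; rewrite -(Radon_Nikodym_SigmaFinite.f_integral dom).
Qed.

(** Integration against the density, for a signed integrand: the non-negative
    case is applied to the positive and the negative part. *)
Lemma integral_normal_prob m s (f : R -> R) : measurable_fun setT f ->
  mu.-integrable setT (EFin \o (fun x => f x * normal_pdf m s x)) ->
  (normal_prob m s).-integrable setT (EFin \o f) /\
  \int[normal_prob m s]_x f x = \int[mu]_x (f x * normal_pdf m s x).
Proof.
move=> mf iff.
have nE (g : R -> R) : measurable_fun setT g -> (forall x, 0 <= g x) ->
    (\int[normal_prob m s]_x (g x)%:E = \int[mu]_x (g x * normal_pdf m s x)%:E)%E.
  move=> mg g0; rewrite ge0_integral_normal_prob//.
  exact/measurable_EFinP.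
have if_ : (normal_prob m s).-integrable setT (EFin \o f).
  apply/integrableP; split; first exact/measurable_EFinP.
  rewrite (nE (fun x => `|f x|))//; last exact: measurableT_comp.
  move/integrableP : iff => [_]; congr (_ < _)%E.
  apply: eq_integral => x _ /=.
  by rewrite normrM (ger0_norm (normal_pdf_ge0 _ _ _)).
split => //; rewrite /Rintegral; congr fine.
rewrite [LHS]integralE [RHS]integralE; congr (_ - _)%E.
- transitivity (\int[normal_prob m s]_x (Num.max (f x) 0)%:E)%E.
    by apply: eq_integral => x _; rewrite funeposE /= EFin_max.
  rewrite nE; [|exact: measurable_funrpos|by move=> x; rewrite le_max lexx orbT].
  apply: eq_integral => x _; rewrite funeposE /= -EFin_max.
  by rewrite maxr_pMl ?normal_pdf_ge0// mul0r.
- transitivity (\int[normal_prob m s]_x (Num.max (- f x) 0)%:E)%E.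
    by apply: eq_integral => x _; rewrite funenegE /= EFin_max.
  rewrite nE; [|exact: measurable_funrneg|by move=> x; rewrite le_max lexx orbT].
  apply: eq_integral => x _; rewrite funenegE /= -EFin_max.
  by rewrite maxr_pMl ?normal_pdf_ge0// mul0r mulNr.
Qed.

End normal_integrals.

Lemma Rcontinuous_FTC2 (R : realType) (f F : R -> R) (a b : R) :
  (forall x : R, is_derive x 1 F (f x)) -> continuous f -> a < b ->
  \int[lebesgue_measure]_(x in `[a, b]) f x = F b - F a.
Proof.
move=> dF cf ab.
have cF : continuous F.
  move=> x; apply: differentiable_continuous; apply/derivable1_diffP.
  by case: (dF x).
rewrite /Rintegral (@continuous_FTC2 _ f F)//.
- exact: continuous_subspaceT.
- split.
  + by move=> x _; case: (dF x).
  + by apply: cvg_at_right_filter; exact: cF.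
  + by apply: cvg_at_left_filter; exact: cF.
- by move=> x _; rewrite derive1E; case: (dF x).
Qed.

Section normal_moments.
Context (R : realType) (m s : R).
Hypothesis s0 : s != 0.
Local Notation mu := (@lebesgue_measure R).
Local Notation pdf := (normal_pdf m s).
Local Notation nu := (@normal_prob R m s).

(** Completing the square: exponential tilting only shifts the mean.  This is
    the source of all integrability statements below, since it dominates
    polynomial growth by shifted Gaussian densities. *)
Lemma normal_pdf_tilt (b x : R) :
  expR (b * (x - m)) * pdf x =
  expR (b ^+ 2 * s ^+ 2 / 2) * normal_pdf (m + b * s ^+ 2) s x.
Proof.
rewrite !normal_pdfE// /normal_fun mulrCA [RHS]mulrCA; congr (_ * _).
by rewrite -!expRD; congr expR; field.
Qed.

Lemma integrable_exp_pdf (b : R) :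
  mu.-integrable setT (EFin \o (fun x => expR (b * (x - m)) * pdf x)).
Proof.
rewrite (_ : (fun x => _) = (fun x => expR (b ^+ 2 * s ^+ 2 / 2) *
    normal_pdf (m + b * s ^+ 2) s x)); last first.
  by apply/funext => x; rewrite normal_pdf_tilt.
by apply: integrableZ_EFin; exact: integrable_normal_pdf.
Qed.

Lemma normal_mgf (b : R) : nu.-integrable setT (EFin \o (fun x => expR (b * (x - m)))) /\
  \int[nu]_x expR (b * (x - m)) = expR (b ^+ 2 * s ^+ 2 / 2).
Proof.
have [|//|-> ->] := @integral_normal_prob _ m s (fun x => expR (b * (x - m))).
- apply: measurableT_comp => //; apply: measurable_funM => //.
  exact: measurable_funB.
- exact: integrable_exp_pdf.
split=> //.
under eq_Rintegral do rewrite normal_pdf_tilt.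
rewrite RintegralZl//; last exact: integrable_normal_pdf.
by rewrite {1}/Rintegral integral_normal_pdf mulr1.
Qed.

Lemma integrable_poly_pdf (f : R -> R) (C : R) (k : nat) :
  measurable_fun setT f -> (forall x, `|f x| <= C * (1 + `|x - m|) ^+ k) ->
  mu.-integrable setT (EFin \o (fun x => f x * pdf x)).
Proof.
move=> mf fC.
have C0 : 0 <= C.
  have := fC m; rewrite subrr normr0 addr0 expr1n mulr1.
  exact: le_trans.
pose g x := C * (expR (k%:R * (x - m)) * pdf x + expR (- k%:R * (x - m)) * pdf x).
apply: (@integrable_le _ _ _ mu _ g).
- by apply: measurable_funM => //; exact: measurable_normal_pdf.
- by apply: integrableZ_EFin; apply: integrableD_EFin; exact: integrable_exp_pdf.
move=> x; rewrite /g normrM (ger0_norm (normal_pdf_ge0 _ _ _)) -mulrDl mulrA.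
apply: ler_wpM2r; first exact: normal_pdf_ge0.
rewrite (le_trans (fC x))// ler_wpM2l// mulNr.
rewrite (@le_trans _ _ (expR (k%:R * `|x - m|)))//.
  rewrite expRM_natl lerXn2r ?nnegrE ?addr_ge0 ?expR_ge0//.
  exact: expR_ge1Dx.
by have [y0|y0] := ger0P (x - m); rewrite ?mulrN ?lerDl ?lerDr expR_ge0.
Qed.

Lemma integrable_poly_normal (f : R -> R) (C : R) (k : nat) :
  measurable_fun setT f -> (forall x, `|f x| <= C * (1 + `|x - m|) ^+ k) ->
  nu.-integrable setT (EFin \o f) /\
  \int[nu]_x f x = \int[mu]_x (f x * pdf x).
Proof.
by move=> mf fC; apply: integral_normal_prob => //; exact: integrable_poly_pdf fC.
Qed.

Lemma is_derive_normal_pdf (x : R) :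
  is_derive x 1 pdf (- (x - m) / s ^+ 2 * pdf x).
Proof.
rewrite normal_pdfE// /normal_fun.
have dq : is_derive x 1 (fun x => - (x - m) ^+ 2 / (s ^+ 2 *+ 2)) (- (x - m) / s ^+ 2).
  apply: is_derive_eq; rewrite /GRing.scale/=.
  by field.
apply: is_derive_eq.
by rewrite /GRing.scale/=; ring.
Qed.

End normal_moments.

Section normal_stein.
Context (R : realType) (m s : R).
Hypothesis s0 : s != 0.
Local Notation mu := (@lebesgue_measure R).
Local Notation pdf := (normal_pdf m s).
Local Notation nu := (@normal_prob R m s).

(** Decay at the rate of the inverse square of the distance to the mean, so
    that a function of linear growth times the density vanishes at infinity. *)
Lemma normal_pdf_decay : exists2 K : R, 0 <= K & forall y : R, 0 <= y ->
  (1 + y) * pdf (m + y) <= K / (1 + y) /\ (1 + y) * pdf (m - y) <= K / (1 + y).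
Proof.
pose K := expR (2 ^+ 2 * s ^+ 2 / 2) * normal_peak s.
have K0 : 0 <= K by rewrite mulr_ge0 ?expR_ge0 ?normal_peak_ge0.
exists K => // y y0.
have y1 : 0 < 1 + y by lra.
have yE : (1 + y) ^+ 2 <= expR (2 * y).
  by rewrite expRM_natl lerXn2r ?nnegrE ?expR_ge0 ?expR_ge1Dx//; exact: ltW.
have key (b z : R) : b ^+ 2 = 2 ^+ 2 -> b * (z - m) = 2 * y ->
    (1 + y) * pdf z <= K / (1 + y).
  move=> b2 bz; rewrite ler_pdivlMr// mulrAC -expr2.
  rewrite (@le_trans _ _ (expR (b * (z - m)) * pdf z))//.
    by rewrite bz ler_wpM2r// normal_pdf_ge0.
  by rewrite normal_pdf_tilt// b2 ler_wpM2l ?expR_ge0// normal_pdf_ub.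
split; first by apply: (key 2) => //; ring.
by apply: (key (- 2)); ring.
Qed.

(** Gaussian integration by parts: the derivative of [f * pdf] integrates to
    zero, being the limit of its integrals over growing segments centred at the
    mean, whose boundary terms vanish. *)
Lemma normal_stein (f f' : R -> R) (C : R) :
  (forall x : R, is_derive x 1 f (f' x)) -> continuous f' ->
  (forall x, `|f x| <= C * (1 + `|x - m|)) ->
  (forall x, `|f' x| <= C * (1 + `|x - m|)) ->
  \int[nu]_x ((x - m) * f x) = s ^+ 2 * \int[nu]_x f' x.
Proof.
move=> df cf' fC f'C.
have C0 : 0 <= C.
  have := fC m; rewrite subrr normr0 addr0 mulr1; exact: le_trans.
have cf : continuous f.
  move=> x; apply: differentiable_continuous; apply/derivable1_diffP.
  by case: (df x).
have mf := continuous_measurable_fun cf.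
have mf' := continuous_measurable_fun cf'.
have mpdf := measurable_normal_pdf m s.
have mid : measurable_fun setT (fun x : R => x - m) by exact: measurable_funB.
pose G x := f x * pdf x.
pose G' x := f' x * pdf x - s ^- 2 * ((x - m) * f x * pdf x).
have dG (x : R) : is_derive x 1 G (G' x).
  have := df x; have := is_derive_normal_pdf m s0 x => dp dfx.
  apply: is_derive_eq.
  by rewrite /G' /GRing.scale/=; field.
have cG' : continuous G'.
  move=> x; apply: cvgB; apply: cvgM; [exact: cf'|exact: continuous_normal_pdf|exact: cvg_cst|].
  apply: cvgM; last exact: continuous_normal_pdf.
  by apply: cvgM; [apply: cvgB; [exact: cvg_id|exact: cvg_cst]|exact: cf].
have i1 : mu.-integrable setT (EFin \o (fun x => f' x * pdf x)).
  by apply: (@integrable_poly_pdf _ _ _ _ _ C 1).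
have bxf (x : R) : `|(x - m) * f x| <= C * (1 + `|x - m|) ^+ 2.
  rewrite normrM expr2 mulrA [leRHS]mulrC ler_pM//.
  by rewrite lerDr.
have i2 : mu.-integrable setT (EFin \o (fun x => (x - m) * f x * pdf x)).
  apply: (@integrable_poly_pdf _ _ _ _ _ C 2) => //.
  exact: measurable_funM.
have iG' : mu.-integrable setT (EFin \o G').
  by apply: integrableB_EFin => //; exact: integrableZ_EFin.
pose D n : set R := `[m - n.+1%:R, m + n.+1%:R]%classic.
have ID n : \int[mu]_x (G' \_ (D n)) x = G (m + n.+1%:R) - G (m - n.+1%:R).
  rewrite -Rintegral_mkcond; apply: Rcontinuous_FTC2 => //.
  by rewrite ltrBlDr -addrA ltrDl -mulr2n mulrn_wgt0.
have lim1 : \int[mu]_x (G' \_ (D n)) x @[n --> \oo] --> \int[mu]_x G' x.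
  apply: (@Rdominated_cvg _ _ _ mu _ _ (fun x => `|G' x|)).
  - move=> n; apply/(measurable_restrictT _ _).1; first exact: measurable_itv.
    by apply: measurable_funTS; exact: continuous_measurable_fun.
  - move=> x; apply: cvg_near_cst.
    near=> n; rewrite patchE ifT// inE /D/= in_itv/=.
    have : `|x - m| <= n.+1%:R.
      rewrite (@le_trans _ _ n%:R)// ?ler_nat//.
      by near: n; exact: nbhs_infty_ger.
    by rewrite ler_norml; move=> /andP[]; lra.
  - rewrite (_ : EFin \o _ = (abse \o (EFin \o G')))//.
    exact: integrable_abse.
  - by move=> n x; rewrite patchE; case: ifP => // _; rewrite normr0.
have lim0 : \int[mu]_x (G' \_ (D n)) x @[n --> \oo] --> (0 : R).
  have [K K0 decay] := normal_pdf_decay.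
  apply: norm_cvg0.
  apply: (@squeeze_cvgr _ _ _ _ (cst 0) (fun n => 2 * (C * K) * n.+1%:R^-1)).
  - apply: nearW => n; rewrite normr_ge0/= ID.
    have [d1 d2] := decay n.+1%:R (ler0n _ _).
    rewrite (le_trans (ler_normB _ _))// -mulrA mulr_natl mulr2n.
    have aux (z : R) : `|z - m| = n.+1%:R -> (1 + n.+1%:R) * pdf z <= K / (1 + n.+1%:R) ->
        `|G z| <= C * K * n.+1%:R^-1.
      move=> zm dz; rewrite /G normrM (ger0_norm (normal_pdf_ge0 _ _ _)).
      rewrite (@le_trans _ _ (C * (1 + n.+1%:R) * pdf z))//.
        by rewrite ler_wpM2r ?normal_pdf_ge0// (le_trans (fC z))// zm.
      rewrite -!mulrA ler_wpM2l// (le_trans dz)// ler_wpM2l//.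
      by rewrite lef_pV2 ?posrE ?addr_gt0// lerDr.
    by apply: lerD; apply: aux => //; [rewrite addrC addKr|rewrite addrC addrA addNr add0r normrN];
       rewrite ger0_norm.
  - exact: cvg_cst.
  - rewrite -[X in _ --> X](mulr0 (2 * (C * K))).
    by apply: cvgM; [exact: cvg_cst|exact: cvg_harmonic].
have I0 : \int[mu]_x G' x = 0.
  exact: (cvg_unique _ lim1 lim0).
move: I0; rewrite /G' RintegralB//; last exact: integrableZ_EFin.
rewrite RintegralZl//.
have [_ ->] := @integrable_poly_normal _ m s s0 f' C 1 mf' f'C.
have [_ ->] := @integrable_poly_normal _ m s s0 _ C 2 (measurable_funM mid mf) bxf.
move=> /eqP; rewrite subr_eq0 => /eqP ->.
by rewrite mulrA divff ?mul1r// expf_neq0.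
Unshelve. all: by end_near. Qed.

End normal_stein.

Section normal_characteristic.
Context (R : realType) (m s : R).
Hypothesis s0 : s != 0.
Local Notation nu := (@normal_prob R m s).

Let mdev : measurable_fun setT (fun x : R => x - m).
Proof. exact: measurable_funB. Qed.

Lemma integrable_normal_dev : nu.-integrable setT (EFin \o (fun x => x - m)).
Proof.
apply: (proj1 (@integrable_poly_normal R m s s0 _ 1 1 mdev _)) => x.
by rewrite mul1r expr1 lerDr.
Qed.

Lemma normal_mean : \int[nu]_x x = m.
Proof.
have st : \int[nu]_x ((x - m) * 1) = s ^+ 2 * \int[nu]_x 0.
  apply: (@normal_stein R m s s0 (cst 1) (cst 0) 1).
  - by move=> x; exact: cvg_cst.
  - by move=> x; rewrite normr1 mul1r lerDl.
  - by move=> x; rewrite normr0 mul1r addr_ge0.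
rewrite Rintegral_cst// mul0r mulr0 in st.
rewrite (_ : \int[nu]_x x = \int[nu]_x ((x - m) + m)); last first.
  by apply: eq_Rintegral => x _; rewrite subrK.
rewrite RintegralD//; last 2 first.
  exact: integrable_normal_dev.
  exact: finite_measure_integrable_cst.
rewrite Rintegral_prob_cst.
under eq_Rintegral do rewrite -[_ - _]mulr1.
by rewrite st add0r.
Qed.

Lemma normal_variance : \int[nu]_x ((x - m) ^+ 2) = s ^+ 2.
Proof.
have st : \int[nu]_x ((x - m) * (x - m)) = s ^+ 2 * \int[nu]_x 1.
  apply: (@normal_stein R m s s0 (fun x => x - m) (cst 1) 1).
  - by move=> x; apply: is_derive_eq; rewrite subr0.
  - by move=> x; exact: cvg_cst.
  - by move=> x; rewrite mul1r lerDr.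
  - by move=> x; rewrite normr1 mul1r lerDl.
under eq_Rintegral do rewrite expr2.
by rewrite st Rintegral_prob_cst mulr1.
Qed.

(** As a function of [u] the integral [k] satisfies the linear equation
    [k' = - s ^+ 2 * u * k]: differentiate under the integral sign, then
    integrate by parts.  The phase [b] yields the cosine and the sine
    transforms at once. *)
Lemma normal_cos (u b : R) :
  \int[nu]_x cos (u * (x - m) + b) = cos b * expR (- (s ^+ 2 * u ^+ 2 / 2)).
Proof.
pose f u (x : R) := cos (u * (x - m) + b).
pose k u := \int[nu]_x f u x.
have mlin u' : measurable_fun setT (fun x : R => u' * (x - m) + b).
  apply: measurable_funD => //; apply: measurable_funM => //.
have mf u' : measurable_fun setT (f u').
  by apply: measurableT_comp => //; exact: continuous_measurable_fun (@continuous_cos R).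
have df (u' x : R) : is_derive u' 1 (f ^~ x) (- (x - m) * sin (u' * (x - m) + b)).
  by apply: is_derive_eq; rewrite /GRing.scale/=; ring.
have intf u' : nu.-integrable setT (EFin \o f u').
  by apply: (@integrable_bounded _ _ _ _ _ 1); [exact: mf|move=> x; exact: cos_max].
have iG : nu.-integrable setT (EFin \o (fun x => `|x - m|)).
  rewrite (_ : EFin \o _ = (abse \o (EFin \o (fun x => x - m))))//.
  exact: integrable_abse integrable_normal_dev.
(* Integration by parts, applied to the sine. *)
have st u' : \int[nu]_x ((x - m) * sin (u' * (x - m) + b)) = s ^+ 2 * (u' * k u').
  rewrite -RintegralZl//.
  apply: (@normal_stein R m s s0 _ _ (1 + `|u'|)).
  - by move=> x; apply: is_derive_eq; rewrite /f /GRing.scale/=; ring.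
  - move=> x; apply: cvgM; first exact: cvg_cst.
    apply: (@cvg_comp _ _ _ (fun x : R => u' * (x - m) + b) cos _
      (nbhs (u' * (x - m) + b))); last exact: continuous_cos.
    apply: cvgD; last exact: cvg_cst.
    by apply: cvgM; [exact: cvg_cst|apply: cvgB; [exact: cvg_id|exact: cvg_cst]].
  - move=> x; rewrite (le_trans (sin_max _))// mulrDl mul1r -addrA lerDl.
    by rewrite addr_ge0// mulr_ge0// addr_ge0.
  - move=> x; rewrite normrM (@le_trans _ _ `|u'|)//.
      by rewrite ler_piMr// cos_max.
    by rewrite mulrDr mulr1 mulrDl mul1r addrC addrA lerDr addr_ge0// mulr_ge0.
have part (u' x : R) : partial1of2 f u' x = - (x - m) * sin (u' * (x - m) + b).
  by rewrite partial1of2E; case: (df u' x).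
have dk (u' : R) : is_derive u' 1 k (- (s ^+ 2 * u') * k u').
  have Iu : (`]u' - 1, u' + 1[%classic : set R) u' by rewrite /= in_itv/=; apply/andP; split; lra.
  have derf1 (x y : R) : (`]u' - 1, u' + 1[%classic : set R) x -> [set: R] y ->
      derivable (f ^~ y) x 1.
    by move=> _ _; case: (df x y).
  have G_ub (x y : R) : (`]u' - 1, u' + 1[%classic : set R) x -> [set: R] y ->
      `|partial1of2 f x y| <= `|y - m|.
    by move=> _ _; rewrite part normrM normrN ler_piMr// sin_max.
  have H1 := @derivable_under_integral R _ _ nu f setT measurableT u' _ _ Iu
    (fun x _ => intf x) derf1 _ (fun y => normr_ge0 _) iG G_ub.
  have H2 := @differentiation_under_integral R _ _ nu f setT measurableT u' _ _ Iu
    (fun x _ => intf x) derf1 _ (fun y => normr_ge0 _) iG G_ub.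
  apply: DeriveDef; first exact: H1.
  rewrite -derive1E; apply: etrans H2 _.
  under eq_Rintegral do rewrite part mulNr -mulN1r.
  rewrite RintegralZl//; last first.
    apply: (@integrable_le _ _ _ nu _ (fun x => `|x - m|)) => //.
      apply: measurable_funM => //; apply: measurableT_comp => //.
      exact: continuous_measurable_fun (@continuous_sin R).
      exact: mlin.
    by move=> x; rewrite normrM ler_piMr// sin_max.
  by rewrite st; ring.
(* The integrating factor of the equation satisfied by [k]. *)
pose h u := k u * expR (s ^+ 2 * u ^+ 2 / 2).
have dh (u' : R) : is_derive u' 1 h 0.
  have := dk u' => dku.
  apply: is_derive_eq; rewrite /GRing.scale/=.
  by field.
have h0 : h u = cos b.
  rewrite (is_derive_0_is_cst u 0 dh) /h /k.
  rewrite expr0n/= mulr0 mul0r expR0 mulr1 /f.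
  under eq_Rintegral do rewrite mul0r add0r.
  by rewrite Rintegral_prob_cst.
rewrite -h0 /h -[RHS]mulrA -expRD.
by rewrite subrr expR0 mulr1.
Qed.

End normal_characteristic.

(** The integrand is a multiple of a centred Gaussian density of smaller
    variance. *)
Lemma normal_square_laplace (R : realType) (t : R) : 0 <= t ->
  \int[@normal_prob R 0 1]_x expR (- (t * x ^+ 2)) = (Num.sqrt (1 + 2 * t))^-1.
Proof.
move=> t0; have t1 : 0 < 1 + 2 * t by lra.
pose w := (Num.sqrt (1 + 2 * t))^-1.
have w0 : w != 0 by rewrite invr_neq0// gt_eqF// sqrtr_gt0.
have w_ge0 : 0 <= w by rewrite invr_ge0 sqrtr_ge0.
have w2 : w ^+ 2 = (1 + 2 * t)^-1 by rewrite exprVn sqr_sqrtr// ltW.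
have pE (x : R) : expR (- (t * x ^+ 2)) * normal_pdf 0 1 x = w * normal_pdf 0 w x.
  rewrite !normal_pdfE ?oner_eq0// /normal_fun !subr0 mulrCA.
  rewrite -expRD mulrA; congr (_ * expR _).
    rewrite /normal_peak w2 expr1n mul1r -mulrnAr sqrtrM ?invr_ge0 ?ltW//.
    by rewrite invfM sqrtrV ?ltW// invrK mulrA mulVf ?mul1r// gt_eqF// sqrtr_gt0.
  by rewrite w2; field; rewrite gt_eqF.
have mexp : measurable_fun setT (fun x : R => expR (- (t * x ^+ 2))).
  apply: measurableT_comp => //; apply: measurableT_comp => //.
  by apply: measurable_funM => //; exact: measurable_funX.
have [|_ ->] := @integral_normal_prob R 0 1 _ mexp.
  rewrite (_ : (fun x => _) = (fun x => w * normal_pdf 0 w x)); last first.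
    by apply/funext => x; exact: pE.
  by apply: integrableZ_EFin; exact: integrable_normal_pdf.
under eq_Rintegral do rewrite pE.
rewrite RintegralZl//; last exact: integrable_normal_pdf.
by rewrite /Rintegral integral_normal_pdf mulr1.
Qed.

(** * Moments of a centred Gaussian variable *)

Section transfer.
Context d (T : measurableType d) (R : realType) (P : probability T R).

(** The codomain of [Z] carries the Borel sets of [R] under two presentations;
    the pushforward is taken on [measurableTypeR R], where [nu] lives. *)
Lemma distribution_transfer (Z : {RV P >-> R})
    (nu : probability (measurableTypeR R) R) (f : R -> R) :
  (forall A : set R, measurable A -> distribution P Z A = nu A) ->
  measurable_fun setT f -> nu.-integrable setT (EFin \o f) ->
  P.-integrable setT (EFin \o (f \o Z)) /\
  \int[P]_w f (Z w) = \int[nu]_x f x.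
Proof.
move=> Znu mf /integrableP[_ if_].
have mZ : @measurable_fun _ _ T (measurableTypeR R) setT Z.
  exact: (@measurable_funPT _ _ T R Z).
pose phi_mixin := isMeasurableFun.Build _ _ T (measurableTypeR R) Z mZ.
pose phi : {mfun T >-> measurableTypeR R} := HB.pack (Z : T -> measurableTypeR R) phi_mixin.
have lawE (g : R -> \bar R) :
    (\int[pushforward P phi]_y g y = \int[nu]_y g y)%E.
  by apply: eq_measure_integral => A mA _; exact: Znu.
have mfZ : measurable_fun setT (f \o Z) by exact: measurableT_comp.
have ifZ : P.-integrable setT (EFin \o (f \o Z)).
  apply/integrableP; split; first exact/measurable_EFinP.
  rewrite (_ : (\int[P]_x _)%E = (\int[P]_x ((fun y => `|(f y)%:E|%E) \o phi) x)%E)//.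
  rewrite -[X in (X < _)%E](@ge0_integral_pushforward _ _ _ _ _ phi mZ P setT)//.
    by rewrite lawE.
  by apply/measurable_EFinP; exact: measurableT_comp.
split => //; rewrite /Rintegral; congr fine.
rewrite (_ : (\int[P]_x _)%E = (\int[P]_x ((EFin \o f) \o phi) x)%E)//.
rewrite -[LHS](@integral_pushforward _ _ _ _ _ phi mZ P setT)//.
  exact/measurable_EFinP.
Qed.

(** These are the only consequences of normality used afterwards: the cosine
    transforms of all linear combinations determine the law of a Gaussian
    vector, and the fourth moment gives the required integrability. *)
Lemma centred_gaussian_moments (Z : {RV P >-> R}) :
  gaussian_rv Z -> ('E_P[Z] = 0)%E ->
  exists v : R, [/\ 0 <= v, P.-integrable setT (EFin \o (fun w => Z w ^+ 4)),
    \int[P]_w (Z w ^+ 2) = v & \int[P]_w cos (Z w) = expR (- (v / 2))].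
Proof.
move=> [m [s Zlaw]] EZ0.
have {}EZ0 : \int[P]_w Z w = 0 by rewrite /Rintegral -[0]/(fine 0%E) -EZ0 unlock.
have m4 : measurable_fun setT (fun x : R => x ^+ 4) by exact: measurable_funX.
have m2 : measurable_fun setT (fun x : R => x ^+ 2) by exact: measurable_funX.
have mc : measurable_fun setT (@cos R) by exact: continuous_measurable_fun (@continuous_cos R).
have [s0|s0] := eqVneq s 0.
  have law (f : R -> R) : measurable_fun setT f ->
      P.-integrable setT (EFin \o (f \o Z)) /\ \int[P]_w f (Z w) = f m.
    move=> mf.
    have [||-> ->] := @distribution_transfer Z (@dirac _ (measurableTypeR R) m R) f _ mf.
    - by move=> A mA; rewrite Zlaw// s0 eqxx.
    - apply/integrableP; split; first exact/measurable_EFinP.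
      rewrite integral_dirac//; last first.
        by apply/measurable_EFinP; exact: measurableT_comp.
      by rewrite diracT mul1e ltry.
    split=> //; rewrite /Rintegral integral_dirac//; last exact/measurable_EFinP.
    by rewrite diracT mul1e.
  have m0 : m = 0.
    by have [_] := law id (@measurable_id _ _ _); rewrite EZ0.
  exists 0; split => //.
  - exact: (proj1 (law _ m4)).
  - by rewrite (proj2 (law _ m2)) m0 expr0n.
  - by rewrite (proj2 (law _ mc)) m0 cos0 mul0r oppr0 expR0.
have law (f : R -> R) (C : R) k : measurable_fun setT f ->
    (forall x, `|f x| <= C * (1 + `|x - m|) ^+ k) ->
    P.-integrable setT (EFin \o (f \o Z)) /\
    \int[P]_w f (Z w) = \int[normal_prob m s]_x f x.
  move=> mf fC; apply: distribution_transfer => //.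
    by move=> A mA; rewrite Zlaw// (negbTE s0).
  exact: (proj1 (integrable_poly_normal s0 mf fC)).
have m0 : m = 0.
  have := law id (1 + `|m|) 1%N (@measurable_id _ _ _).
  rewrite EZ0 (normal_mean _ s0) => -[|_ ->//].
  move=> x; rewrite expr1 -[X in `|X|](subrK m x).
  rewrite (le_trans (ler_normD _ _))//.
  by have := mulr_ge0 (normr_ge0 m) (normr_ge0 (x - m)); lra.
rewrite {}m0 in law Zlaw.
exists (s ^+ 2); split.
- exact: sqr_ge0.
- apply: (proj1 (law _ 1 4%N m4 _)) => x.
  by rewrite mul1r subr0 normrX lerXn2r ?nnegrE ?addr_ge0// lerDr.
- rewrite (proj2 (law _ 1 2%N m2 _)).
    rewrite -(normal_variance 0 s0).
    by apply: eq_Rintegral => x _; rewrite subr0.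
  move=> x.
  by rewrite mul1r subr0 normrX lerXn2r ?nnegrE ?addr_ge0// lerDr.
- rewrite (proj2 (law _ 1 0%N mc _)).
    have := normal_cos 0 s0 1 0.
    rewrite cos0 mul1r expr1n mulr1 => <-.
    by apply: eq_Rintegral => x _; rewrite subr0 mul1r addr0.
  by move=> x; rewrite expr0 mulr1 cos_max.
Qed.

End transfer.

(** * The Laplace transform of a Gaussian quadratic form *)

Section hubbard_stratonovich.
Context d (T : measurableType d) (R : realType) (P : probability T R).

(** The Hubbard-Stratonovich trick.  For a standard Gaussian [x] independent of
    everything else, [expR (- t z^2) * cos L] is the mean over [x] of
    [cos (L + sqrt (2 t) * x * z)]; hence a quadratic exponential can be
    integrated as soon as the linear phases can, after exchanging the two
    integrals. *)
Lemma gaussian_linearisation (Q L z : T -> R) (lam t K : R) :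
  measurable_fun setT Q -> measurable_fun setT L -> measurable_fun setT z ->
  (forall w, `|Q w| <= 1) -> 0 <= lam -> 0 <= t ->
  (forall v : R, \int[P]_w (Q w * cos (L w + v * z w)) =
     K * expR (- (v ^+ 2 * lam / 2))) ->
  \int[P]_w (Q w * expR (- (t * z w ^+ 2)) * cos (L w)) =
    K * (Num.sqrt (1 + 2 * (t * lam)))^-1.
Proof.
move=> mQ mL mz Q1 lam0 t0 QL; pose g : probability (measurableTypeR R) R := @normal_prob R 0 1.
pose a := Num.sqrt (2 * t).
have a2 : a ^+ 2 = 2 * t by rewrite sqr_sqrtr ?mulr_ge0.
have m1 : measurable_fun setT (fun p : T * measurableTypeR R =>
    Q p.1 * cos (L p.1 + a * p.2 * z p.1)).
  apply: measurable_funM; first exact: measurableT_comp.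
  apply: measurableT_comp; first exact: continuous_measurable_fun (@continuous_cos R).
  apply: measurable_funD; first exact: measurableT_comp.
  apply: measurable_funM; last exact: measurableT_comp.
  exact: measurable_funM.
transitivity (\int[P]_w \int[g]_x (Q w * cos (L w + a * x * z w))).
  apply: eq_Rintegral => w _; rewrite RintegralZl//; last first.
    apply: (@integrable_bounded _ _ _ g _ 1) => [|x]; last exact: cos_max.
    apply: measurableT_comp; first exact: continuous_measurable_fun (@continuous_cos R).
    apply: measurable_funD => //; exact: measurable_funM.
  have E := @normal_cos R 0 1 (oner_neq0 _) (a * z w) (L w).
  rewrite -mulrA; congr (_ * _); rewrite mulrC; apply: etrans (etrans (esym E) _).
    by rewrite exprMn a2; congr (_ * expR _); field.
  by apply: eq_Rintegral => x _; rewrite subr0; congr cos; ring.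
rewrite (@Rfubini _ _ _ _ _ P g (fun p => Q p.1 * cos (L p.1 + a * p.2 * z p.1)) 1)//; last first.
  by move=> p; rewrite normrM mulr_ile1// cos_max.
rewrite -(@normal_square_laplace R (t * lam)) ?mulr_ge0//.
rewrite -RintegralZl//; last first.
  apply: (@integrable_bounded _ _ _ g _ 1).
    apply: measurableT_comp => //; apply: measurableT_comp => //.
    by apply: measurable_funM => //; exact: measurable_funX.
  move=> x; rewrite ger0_norm ?expR_ge0// expR_le1 oppr_le0.
  by rewrite mulr_ge0 ?sqr_ge0 ?mulr_ge0.
apply: eq_Rintegral => x _; rewrite /= QL; congr (_ * expR _).
by rewrite exprMn a2; field.
Qed.

(** The squares are introduced one coordinate at a time: after [m] steps the
    first [m] coordinates appear quadratically and the others still linearly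
    under the cosine. *)
Lemma gaussian_quadratic_laplace n (Z : 'I_n -> T -> R) (lam : 'I_n -> R) (t : R) :
  (forall k, measurable_fun setT (Z k)) -> (forall k, 0 <= lam k) -> 0 <= t ->
  (forall u : 'I_n -> R, \int[P]_w cos (\sum_(k < n) u k * Z k w) =
     expR (- ((\sum_(k < n) u k ^+ 2 * lam k) / 2))) ->
  \int[P]_w expR (- (t * \sum_(k < n) Z k w ^+ 2)) =
    \prod_(k < n) (Num.sqrt (1 + 2 * (t * lam k)))^-1.
Proof.
move=> mZ lam0 t0 cosZ.
have split_ge m (mn : (m < n)%N) (F : 'I_n -> R) :
    \sum_(k < n | (m <= k)%N) F k = F (Ordinal mn) + \sum_(k < n | (m < k)%N) F k.
  rewrite (bigD1 (Ordinal mn))//=; congr (_ + _); apply: eq_bigl => k.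
  by rewrite ltn_neqAle andbC -(inj_eq val_inj)/= eq_sym.
have split_lt m (mn : (m < n)%N) :
    (fun k : 'I_n => (k < m.+1)%N && (k != Ordinal mn)) =1 (fun k => (k < m)%N).
  by move=> k; rewrite ltnS -(inj_eq val_inj)/= andbC [RHS]ltn_neqAle.
have msum (Q : pred 'I_n) (F : 'I_n -> T -> R) : (forall k, measurable_fun setT (F k)) ->
    measurable_fun setT (fun w => \sum_(k < n | Q k) F k w).
  move=> mF; under eq_fun do rewrite -big_filter.
  exact: measurable_sum.
have claim m : (m <= n)%N -> forall u : 'I_n -> R,
    \int[P]_w (expR (- (t * \sum_(k < n | (k < m)%N) Z k w ^+ 2)) *
      cos (\sum_(k < n | (m <= k)%N) u k * Z k w)) =
    \prod_(k < n | (k < m)%N) (Num.sqrt (1 + 2 * (t * lam k)))^-1 *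
      expR (- ((\sum_(k < n | (m <= k)%N) u k ^+ 2 * lam k) / 2)).
  elim: m => [_ u|m IH mn u].
    rewrite big_pred0// mul1r -cosZ; apply: eq_Rintegral => w _.
    by rewrite big_pred0// mulr0 oppr0 expR0 mul1r.
  have := @gaussian_linearisation
    (fun w => expR (- (t * \sum_(k < n | (k < m)%N) Z k w ^+ 2)))
    (fun w => \sum_(k < n | (m < k)%N) u k * Z k w) (Z (Ordinal mn))
    (lam (Ordinal mn)) t
    (\prod_(k < n | (k < m)%N) (Num.sqrt (1 + 2 * (t * lam k)))^-1 *
      expR (- ((\sum_(k < n | (m < k)%N) u k ^+ 2 * lam k) / 2))).
  move=> H; rewrite [X in X * _](bigD1 (Ordinal mn))//= (eq_bigl _ _ (split_lt m mn)).
  rewrite [X in X * _]mulrC mulrAC -H//.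
  - apply: eq_Rintegral => w _; rewrite [X in expR (- (t * X))](bigD1 (Ordinal mn))//=.
    rewrite (eq_bigl _ _ (split_lt m mn)) mulrDr opprD expRD.
    by rewrite [X in X * _]mulrC.
  - apply: measurableT_comp => //; apply: measurableT_comp => //.
    apply: measurable_funM => //; apply: msum => k; exact: measurable_funX.
  - by apply: msum => k; exact: measurable_funM.
  - move=> w; rewrite ger0_norm ?expR_ge0// expR_le1 oppr_le0 mulr_ge0//.
    by rewrite sumr_ge0// => k _; exact: sqr_ge0.
  - move=> v.
    have := IH (ltnW mn) (fun k => if k == Ordinal mn then v else u k).
    rewrite (split_ge m mn) eqxx => E.
    transitivity (\int[P]_w (expR (- (t * \sum_(k < n | (k < m)%N) Z k w ^+ 2)) *
      cos (\sum_(k < n | (m <= k)%N) (if k == Ordinal mn then v else u k) * Z k w))).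
      apply: eq_Rintegral => w _; congr (_ * cos _).
      rewrite (split_ge m mn) eqxx addrC; congr (_ + _); apply: eq_bigr => k mk.
      by rewrite ifF//; apply/negbTE; rewrite -(inj_eq val_inj)/= gtn_eqF.
    rewrite E -[RHS]mulrA -expRD; congr (_ * expR _).
    rewrite mulrDl opprD addrC; congr (- (_ / _) - _).
    apply: eq_bigr => k mk.
    by rewrite ifF//; apply/negbTE; rewrite -(inj_eq val_inj)/= gtn_eqF.
have := claim n (leqnn n) (fun=> 0).
rewrite [X in expR (- (X / 2))]big_pred0; last by move=> k; rewrite leqNgt ltn_ord.
rewrite mul0r oppr0 expR0 mulr1.
rewrite (eq_bigl predT); last by move=> k; rewrite ltn_ord.
move=> <-; apply: eq_Rintegral => w _.
rewrite [X in cos X]big_pred0; last by move=> k; rewrite leqNgt ltn_ord.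
rewrite cos0 mulr1; congr (expR (- (_ * _))).
by apply: eq_bigl => k; rewrite ltn_ord.
Qed.

End hubbard_stratonovich.

(** * Approximation by exponential polynomials *)

(** The Bernstein polynomial of degree [N] with nodes [phi 0], ..., [phi N]:
    its value at [y] is the mean of [phi] at the number of successes in [N]
    trials of probability [y], and the recursion conditions on the first
    trial.  Compared with the closed form it makes positivity and the second
    moment immediate by induction. *)
Fixpoint bernstein (R : realType) (N : nat) (phi : nat -> R) : {poly R} :=
  if N is N'.+1 then
    'X * bernstein N' (fun i => phi i.+1) + (1 - 'X) * bernstein N' phi
  else (phi 0)%:P.

Section bernstein.
Context (R : realType).
Implicit Types (phi psi : nat -> R) (y : R).

Lemma bernsteinS N phi y : (bernstein N.+1 phi).[y] =
  y * (bernstein N (fun i => phi i.+1)).[y] + (1 - y) * (bernstein N phi).[y].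
Proof. by rewrite /= !hornerE. Qed.

Lemma bernstein_at0 N phi : (bernstein N phi).[0] = phi 0.
Proof.
elim: N => [|N IH]; first by rewrite hornerC.
by rewrite bernsteinS IH mul0r add0r subr0 mul1r.
Qed.

Lemma bernstein_le N phi psi y : 0 <= y <= 1 -> (forall i, phi i <= psi i) ->
  (bernstein N phi).[y] <= (bernstein N psi).[y].
Proof.
move=> /andP[y0 y1]; elim: N phi psi => [|N IH] phi psi le; first by rewrite !hornerC.
by rewrite !bernsteinS lerD ?ler_wpM2l ?subr_ge0 ?IH.
Qed.

(** The mean of [(B - c)^2] is the squared bias plus the variance of a binomial
    variable [B]. *)
Lemma bernstein_quadratic N (a b c y : R) :
  (bernstein N (fun i => a + b * (i%:R - c) ^+ 2)).[y] =
  a + b * ((N%:R * y - c) ^+ 2 + N%:R * (y * (1 - y))).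
Proof.
elim: N c => [|N IH] c; first by rewrite hornerC; ring.
rewrite bernsteinS IH.
rewrite (_ : (fun i => _) = (fun i => a + b * (i%:R - (c - 1)) ^+ 2)).
  by rewrite IH -natr1; ring.
by apply/funext => i; rewrite -natr1; congr (_ + _ * _ ^+ 2); ring.
Qed.

Lemma bernstein_bound N phi (M y : R) : 0 <= y <= 1 -> (forall i, `|phi i| <= M) ->
  `|(bernstein N phi).[y]| <= M.
Proof.
move=> y01 phiM.
have cstE c : (bernstein N (fun=> c)).[y] = c.
  have := bernstein_quadratic N c 0 0 y; rewrite mul0r addr0; apply: etrans.
  by congr _.[_]; congr bernstein; apply/funext => i; rewrite mul0r addr0.
rewrite ler_norml -[X in X <= _ <= _]cstE -[X in _ <= _ <= X]cstE.
by apply/andP; split; apply: bernstein_le => // i;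
  have := phiM i; rewrite ler_norml => /andP[].
Qed.

(** Chebyshev's argument.  The statement is pointwise because the function to
    which it is applied is discontinuous at [0]. *)
Lemma bernstein_cvg (q : R -> R) (M y : R) : 0 <= y <= 1 ->
  (forall z, `|q z| <= M) -> {for y, continuous q} ->
  (bernstein N.+1 (fun i => q (i%:R / N.+1%:R))).[y] @[N --> \oo] --> q y.
Proof.
move=> y01 qM cq; have /andP[y0 y1] := y01.
have M0 : 0 <= M by apply: le_trans (qM 0).
apply/cvgrPdist_le => e e0.
have e20 : 0 < e / 2 by rewrite divr_gt0.
have /cvgrPdist_le/(_ _ e20)/nbhs_ballP[r /= r0 qr] := cq.
pose B := 2 * M / r ^+ 2.
have B0 : 0 <= B by rewrite /B divr_ge0 ?sqr_ge0 // mulr_ge0.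
(* Near [y] by continuity, elsewhere because the quadratic term exceeds [2 * M]. *)
have key z : `|q z - q y| <= e / 2 + B * (z - y) ^+ 2.
  have [zr|rz] := ltP `|y - z| r.
    rewrite distrC (le_trans (qr z zr))// lerDl mulr_ge0 ?sqr_ge0//.
  rewrite (@le_trans _ _ (2 * M))//.
    by have := ler_normB (q z) (q y); have := qM z; have := qM y; lra.
  rewrite (@le_trans _ _ (B * (z - y) ^+ 2))//; last by rewrite lerDr ltW.
  rewrite /B -mulrA ler_peMr ?mulr_ge0// mulrC ler_pdivlMr ?exprn_gt0// mul1r.
  rewrite -[leRHS]real_normK ?num_real// distrC lerXn2r ?nnegrE//.
  by rewrite ltW.
near=> N; set n := N.+1%:R : R.
have n0 : 0 < n by rewrite ltr0n.
(* The nodes are rescaled by [n], hence the curvature by [n ^+ 2]. *)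
pose b := B / n ^+ 2.
have iE i : B * (i%:R / n - y) ^+ 2 = b * (i%:R - n * y) ^+ 2.
  by rewrite /b; field; rewrite gt_eqF.
have up : (bernstein N.+1 (fun i => q (i%:R / n))).[y] <=
    q y + e / 2 + b * (n * (y * (1 - y))).
  have := bernstein_quadratic N.+1 (q y + e / 2) b (n * y) y.
  rewrite subrr expr0n add0r => <-; apply: bernstein_le => // i.
  have := key (i%:R / n); rewrite iE ler_norml => /andP[_].
  by rewrite lerBlDl addrA.
have lo : q y - e / 2 - b * (n * (y * (1 - y))) <=
    (bernstein N.+1 (fun i => q (i%:R / n))).[y].
  have := bernstein_quadratic N.+1 (q y - e / 2) (- b) (n * y) y.
  rewrite subrr expr0n add0r mulNr => <-; apply: bernstein_le => // i.
  have := key (i%:R / n); rewrite iE ler_norml => /andP[h _].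
  by rewrite mulNr; move: h; lra.
have small : b * (n * (y * (1 - y))) <= e / 2.
  rewrite (@le_trans _ _ (B / n))//.
    rewrite /b (_ : _ * _ = B / n * (y * (1 - y))); last by field; rewrite gt_eqF.
    have yy : y * (1 - y) <= 1 by rewrite mulr_ile1 ?subr_ge0//; lra.
    by rewrite ler_piMr// divr_ge0// ltW.
  rewrite ler_pdivrMr// -ler_pdivrMl ?divr_gt0//.
  rewrite (@le_trans _ _ N%:R) ?ler_nat//.
  by near: N; exact: nbhs_infty_ger.
rewrite ler_norml; apply/andP; split; lra.
Unshelve. all: by end_near. Qed.

End bernstein.

Lemma is_derive_sum_fun (R : realType) (N : nat) (h dh : nat -> R -> R) (x : R) :
  (forall i, is_derive x 1 (h i) (dh i x)) ->
  is_derive x 1 (fun x => \sum_(i < N) h i x) (\sum_(i < N) dh i x).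
Proof.
move=> hdh.
have := @is_derive_sum _ _ _ N (fun i => h i) x 1 (fun i => dh i x) (fun i => hdh i).
by congr is_derive; apply/funext => y; rewrite fct_sumE.
Qed.

(** The function [q (expR (- x)) = f' x] turns the half-line into the interval
    [0 < y <= 1]; its Bernstein polynomials give exponential polynomials
    converging to [f'], and integrating them term by term gives antiderivatives
    converging to [f].  Setting [q 0 = 0] kills the constant term, whose
    antiderivative would not be an exponential polynomial.  Convergence is
    pointwise with uniform bounds, which is what dominated convergence needs. *)
Lemma exp_poly_approximation (R : realType) (f f' : R -> R) (M : R) :
  (forall x : R, is_derive x 1 f (f' x)) -> continuous f' ->
  (forall x, `|f' x| <= M) ->
  exists (sz : nat -> nat) (a : nat -> nat -> R) (c : nat -> R),
    let F N (x : R) := c N + \sum_(i < sz N) a N i * expR (- (i%:R * x)) in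
    let F' N (x : R) := \sum_(i < sz N) a N i * (- i%:R * expR (- (i%:R * x))) in
    [/\ forall N (x : R), 0 <= x -> `|F' N x| <= M,
        forall N (x : R), 0 <= x -> `|F N x| <= `|f 0| + M * x,
        forall x : R, 0 <= x -> F' N x @[N --> \oo] --> f' x &
        forall x : R, 0 <= x -> F N x @[N --> \oo] --> f x].
Proof.
move=> df cf' f'M.
have M0 : 0 <= M := le_trans (normr_ge0 _) (f'M 0).
pose q (y : R) := if 0 < y then f' (- ln y) else 0.
have qM y : `|q y| <= M by rewrite /q; case: ifP => _ //; rewrite normr0.
have cq (y : R) : 0 < y -> {for y, continuous q}.
  move=> y0; rewrite /prop_for /continuous_at {2}/q y0.
  have : f' (- ln z) @[z --> y] --> f' (- ln y).
    apply: (@cvg_comp _ _ _ (fun z => - ln z) f' _ (nbhs (- ln y))); last exact: cf'.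
    by apply: cvgN; exact: continuous_ln.
  apply: cvg_trans; apply: near_eq_cvg; near=> z.
  by rewrite /q ifT//; near: z; exact: lt_nbhsr.
pose p N := bernstein N.+1 (fun i => q (i%:R / N.+1%:R)).
have p0 N : (p N)`_0 = 0.
  by rewrite -horner_coef0 bernstein_at0 mul0r /q ltxx.
pose a N i := - (p N)`_i / i%:R.
pose F0 N (x : R) := \sum_(i < size (p N)) a N i * expR (- (i%:R * x)).
pose F' N (x : R) := \sum_(i < size (p N)) a N i * (- i%:R * expR (- (i%:R * x))).
have F'E N x : F' N x = (p N).[expR (- x)].
  rewrite horner_coef; apply: eq_bigr => -[[|i] ilt] _ /=.
    by rewrite p0 /a p0 !(oppr0, mul0r).
  by rewrite -mulrN expRM_natl /a mulrA mulrN !mulNr opprK divfK ?pnatr_eq0.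
have e01 (x : R) : 0 <= x -> 0 <= expR (- x) <= 1.
  by move=> x0; rewrite expR_ge0 expR_le1 oppr_le0.
have F'M N (x : R) : 0 <= x -> `|F' N x| <= M.
  by move=> x0; rewrite F'E bernstein_bound// e01.
have F'cvg (x : R) : 0 <= x -> F' N x @[N --> \oo] --> f' x.
  move=> x0; have := bernstein_cvg (e01 _ x0) qM (cq _ (expR_gt0 (- x))).
  rewrite {2}/q expR_gt0 expRK opprK; apply: cvg_trans.
  by apply: near_eq_cvg; apply: nearW => N; rewrite F'E.
pose F N x := (f 0 - F0 N 0) + F0 N x.
have F00 N : F N 0 = f 0 by rewrite /F subrK.
have dF N (x : R) : is_derive x 1 (F N) (F' N x).
  have d0 : is_derive x 1 (F0 N) (F' N x).
    apply: (@is_derive_sum_fun R _ (fun i x => a N i * expR (- (i%:R * x)))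
      (fun i x => a N i * (- i%:R * expR (- (i%:R * x))))) => i.
    by apply: is_derive_eq; rewrite /GRing.scale/=; ring.
  have -> : F N = cst (f 0 - F0 N 0) + F0 N by [].
  by apply: is_derive_eq; rewrite add0r.
have cF' N : continuous (F' N).
  move=> x; rewrite (_ : F' N = (horner (p N)) \o (fun x => expR (- x))); last first.
    by apply/funext => y; exact: F'E.
  apply: continuous_comp; last exact: continuous_horner.
  apply: (@cvg_comp _ _ _ (fun x : R => - x) expR _ (nbhs (- x))).
    by apply: cvgN; exact: cvg_id.
  exact: continuous_expR.
have cF N : continuous (F N).
  move=> x; apply: differentiable_continuous; apply/derivable1_diffP.
  by case: (dF N x).
exists (fun N => size (p N)), a, (fun N => f 0 - F0 N 0); split => //.
- move=> N x x0.
  have [c /[!in_itv]/= /andP[c0 cx] ] := @MVT_segment R (F N) (F' N) 0 x x0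
    (fun y _ => dF N y) (continuous_subspaceT (cF N)).
  rewrite F00 subr0 => /eqP; rewrite subr_eq => /eqP; rewrite addrC => E.
  rewrite -/(F0 N x) -/(F N x) E (le_trans (ler_normD _ _))// lerD2l normrM (ger0_norm x0).
  by rewrite ler_wpM2r// F'M.
move=> x; rewrite le_eqVlt => /predU1P[<-|x0].
  apply: cvg_near_cst; apply: nearW => N; exact: F00.
have FE N : F N x = f 0 + \int[lebesgue_measure]_(y in `[0, x]) F' N y.
  by rewrite (Rcontinuous_FTC2 (dF N) (cF' N) x0) F00 addrC subrK.
have fE : f x = f 0 + \int[lebesgue_measure]_(y in `[0, x]) f' y.
  by rewrite (Rcontinuous_FTC2 df cf' x0) addrC subrK.
rewrite fE.
have : f 0 + \int[lebesgue_measure]_(y in `[0, x]) F' N y @[N --> \oo] -->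
   f 0 + \int[lebesgue_measure]_(y in `[0, x]) f' y.
  apply: cvgD; first exact: cvg_cst.
  rewrite Rintegral_mkcond; under eq_fun do rewrite Rintegral_mkcond.
  apply: (@Rdominated_cvg _ _ _ lebesgue_measure _ _ ((cst M) \_ `[0, x])).
  - move=> N; apply/(measurable_restrictT _ _).1; first exact: measurable_itv.
    by apply: measurable_funTS; exact: continuous_measurable_fun.
  - move=> y; rewrite patchE; case: ifPn => [|/negbTE yx].
      rewrite inE/= in_itv/= => /andP[y0 yx].
      apply: cvg_trans (F'cvg y y0); apply: near_eq_cvg; apply: nearW => N.
      by rewrite patchE ifT// inE/= in_itv/= y0.
    by apply: cvg_near_cst; apply: nearW => N; rewrite patchE yx.
  - rewrite -restrict_EFin; apply/integrable_restrict => //=; rewrite setTI.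
    apply: continuous_compact_integrable; first exact: segment_compact.
    by apply: continuous_subspaceT => y; exact: cvg_cst.
  - move=> N y; rewrite !patchE; case: ifPn => [|_]; last by rewrite normr0.
    by rewrite inE/= in_itv/= => /andP[y0 _]; exact: F'M.
apply: cvg_trans; apply: near_eq_cvg; apply: nearW => N.
by rewrite -FE.
Unshelve. all: by end_near. Qed.

(** * The zero-bias identity *)

Section gamma_zero_bias.
Context d (T : measurableType d) d' (E : measurableType d') (R : realType).
Variables (P : probability T R) (Q : probability E R).
Variables (n : nat) (lam : 'I_n -> R) (S : T -> R) (chi : E -> R).
Hypothesis lam0 : forall k, 0 <= lam k.
Hypothesis mS : measurable_fun setT S.
Hypothesis S0 : forall w, 0 <= S w.
Hypothesis iS2 : P.-integrable setT (EFin \o (fun w => S w ^+ 2)).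
Hypothesis ES : \int[P]_w S w = \sum_(k < n) lam k.
Hypothesis laplaceS : forall t : R, 0 <= t ->
  \int[P]_w expR (- (t * S w)) = \prod_(k < n) (Num.sqrt (1 + 2 * (t * lam k)))^-1.
Hypothesis mchi : measurable_fun setT chi.
Hypothesis chi0 : forall e, 0 <= chi e.
Hypothesis laplace_chi : forall a : R, 0 <= a ->
  \int[Q]_e expR (- (a * chi e)) = (1 + 2 * a)^-1.

Let m := \sum_(k < n) lam k.
Let PQ : probability _ R := (P \x Q)%E.

Lemma integrable_S : P.-integrable setT (EFin \o S).
Proof.
apply: (@integrable_le _ _ _ P _ (fun w => 1 + S w ^+ 2)) => //.
  by apply: integrableD_EFin => //; exact: finite_measure_integrable_cst.
by move=> w; rewrite ger0_norm//; nra.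
Qed.

Let L (t : R) := \int[P]_w expR (- (t * S w)).

Let one_plus_gt0 (t : R) k : 0 <= t -> 0 < 1 + 2 * (t * lam k).
Proof. by move=> t0; rewrite ltr_wpDr// mulr_ge0// mulr_ge0. Qed.

(** The logarithmic form of the product, convenient for differentiation. *)
Lemma laplace_exp_ln (t : R) : 0 <= t ->
  L t = expR (- (\sum_(k < n) ln (1 + 2 * (t * lam k))) / 2).
Proof.
move=> t0; rewrite /L laplaceS// mulNr mulr_suml -sumrN expR_sum.
apply: eq_bigr => k _; have p := one_plus_gt0 k t0.
rewrite expRN; congr (_^-1); apply/eqP.
rewrite -(eqrXn2 (ltn0Sn 1)) ?sqrtr_ge0 ?expR_ge0// sqr_sqrtr ?ltW//.
by rewrite -expRM_natr divfK ?pnatr_eq0// lnK.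
Qed.

Let is_derive_laplace_ln (t : R) : 0 < t ->
  is_derive t 1 (fun t : R => expR (- (\sum_(k < n) ln (1 + 2 * (t * lam k))) / 2))
   (- (\sum_(k < n) lam k / (1 + 2 * (t * lam k))) * L t).
Proof.
move=> t0; rewrite laplace_exp_ln ?ltW//.
have d1 (k : 'I_n) : is_derive t 1 (fun t : R => ln (1 + 2 * (t * lam k)))
    (2 * (lam k / (1 + 2 * (t * lam k)))).
  have p := one_plus_gt0 k (ltW t0).
  have -> : (fun t : R => ln (1 + 2 * (t * lam k))) =
    (@ln R) \o (fun t : R => 1 + 2 * (t * lam k)) by [].
  have dl := @is_derive1_ln R _ p.
  have di : is_derive t 1 (fun t : R => 1 + 2 * (t * lam k)) (2 * lam k).
    by apply: is_derive_eq; rewrite /GRing.scale/=; ring.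
  by apply: is_derive_eq; rewrite /GRing.scale/=; field; rewrite gt_eqF.
have d2 := is_derive_sum d1.
have -> : (fun t : R => expR (- (\sum_(k < n) ln (1 + 2 * (t * lam k))) / 2)) =
   (fun t : R => expR (- ((\sum_(k < n) (fun t : R => ln (1 + 2 * (t * lam k)))) t) / 2)).
  by apply/funext => x; rewrite fct_sumE.
apply: is_derive_eq.
rewrite fct_sumE /GRing.scale/= -mulr_sumr; by field.
Qed.

(** Minus the derivative of the Laplace transform, computed once under the
    integral sign and once on its closed form. *)
Lemma laplace_moment (t : R) : 0 < t -> \int[P]_w (S w * expR (- (t * S w))) =
  (\sum_(k < n) lam k / (1 + 2 * (t * lam k))) * L t.
Proof.
move=> t0; pose f (t : R) w := expR (- (t * S w)).
have mf (t' : R) : measurable_fun setT (f t').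
  by apply: measurableT_comp => //; apply: measurableT_comp => //; exact: measurable_funM.
have df (x : R) w : is_derive x 1 (f ^~ w) (- (S w * expR (- (x * S w)))).
  by apply: is_derive_eq; rewrite /GRing.scale/=; ring.
have It : (`]0, 2 * t[%classic : set R) t by rewrite /= in_itv/=; apply/andP; split; lra.
have pos (x : R) : (`]0, 2 * t[%classic : set R) x -> 0 < x.
  by rewrite /= in_itv/= => /andP[].
have intf (x : R) : (`]0, 2 * t[%classic : set R) x -> P.-integrable setT (EFin \o f x).
  move=> /pos x0; apply: (@integrable_bounded _ _ _ P _ 1) => // w.
  by rewrite /f ger0_norm ?expR_ge0// expR_le1 oppr_le0 mulr_ge0// ltW.
have derf1 (x : R) w : (`]0, 2 * t[%classic : set R) x -> [set: T] w -> derivable (f ^~ w) x 1.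
  by move=> _ _; case: (df x w).
have part (x : R) w : partial1of2 f x w = - (S w * expR (- (x * S w))).
  by rewrite partial1of2E; case: (df x w).
have G_ub (x : R) w : (`]0, 2 * t[%classic : set R) x -> [set: T] w -> `|partial1of2 f x w| <= S w.
  move=> /pos x0 _; rewrite part normrN normrM ger0_norm// ler_piMr//.
  by rewrite ger0_norm ?expR_ge0// expR_le1 oppr_le0 mulr_ge0// ltW.
have H1 := @differentiation_under_integral R _ _ P f setT measurableT t _ _ It
    intf derf1 _ S0 integrable_S G_ub.
have H2 : is_derive t 1 L (- (\sum_(k < n) lam k / (1 + 2 * (t * lam k))) * L t).
  apply: near_eq_is_derive (is_derive_laplace_ln t0).
  near=> x; rewrite -laplace_exp_ln// ltW//; near: x.
  exact: lt_nbhsr.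
have H3 : \int[P]_w (- (S w * expR (- (t * S w)))) =
    - (\sum_(k < n) lam k / (1 + 2 * (t * lam k))) * L t.
  case: H2 => _ <-; rewrite -derive1E.
  rewrite [RHS]H1; apply: eq_Rintegral => w _; exact/esym/part.
rewrite mulNr in H3; rewrite -[RHS]opprK -H3.
under [in RHS]eq_Rintegral do rewrite -mulN1r.
rewrite RintegralZl//; first by rewrite mulN1r opprK.
apply: (@integrable_le _ _ _ P _ S) => //.
- by apply: measurable_funM => //; exact: mf.
- exact: integrable_S.
move=> w; rewrite normrM ger0_norm// ler_piMr//.
by rewrite ger0_norm ?expR_ge0// expR_le1 oppr_le0 mulr_ge0// ltW.
Unshelve. all: by end_near. Qed.


Let shifted (k : 'I_n) (z : T * E) := S z.1 + lam k * chi z.2.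

Let shifted_ge0 k z : 0 <= shifted k z.
Proof. by rewrite addr_ge0// mulr_ge0. Qed.

Let measurable_shifted k : measurable_fun setT (shifted k).
Proof.
apply: measurable_funD; first exact: measurableT_comp.
by apply: measurable_funM => //; exact: measurableT_comp.
Qed.

(** The identity [E ((S - m) F(S)) = sum_k 2 lam_k^2 E (F' (S + lam_k chi))],
    with [chi] independent of [S], together with the integrability of all terms
    so that such pairs can be added.  For the sum [S] of [lam_k N_k^2] with
    independent standard Gaussian [N_k] it is what Gaussian integration by
    parts gives; here it is derived from the Laplace transform alone. *)
Definition zero_biased (F F' : R -> R) := [/\
  P.-integrable setT (EFin \o (fun w => (S w - m) * F (S w))),
  forall k, PQ.-integrable setT (EFin \o (fun z => F' (shifted k z))) &
  \int[P]_w ((S w - m) * F (S w)) =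
  \sum_(k < n) 2 * lam k ^+ 2 * \int[PQ]_z F' (shifted k z)].

Let mexp (t : R) : measurable_fun setT (fun x : R => expR (- (t * x))).
Proof. by apply: measurableT_comp => //; apply: measurableT_comp => //; exact: measurable_funM. Qed.

Let exp_le1 (t x : R) : 0 <= t -> 0 <= x -> `|expR (- (t * x))| <= 1.
Proof.
by move=> t0 x0; rewrite ger0_norm ?expR_ge0// expR_le1 oppr_le0 mulr_ge0.
Qed.

(** For exponentials both sides are explicit: the left-hand side comes from the
    derivative of the Laplace transform, and the factor
    [(1 + 2 t lam_k)^-1] on the right is the Laplace transform of
    [lam_k * chi]. *)
Lemma zero_biased_exp (t : R) : 0 <= t ->
  zero_biased (fun x => expR (- (t * x))) (fun x => - t * expR (- (t * x))).
Proof.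
move=> t0.
have iexp : P.-integrable setT (EFin \o (fun w => expR (- (t * S w)))).
  apply: (@integrable_bounded _ _ _ P _ 1) => [|w]; last exact: exp_le1.
  exact: (measurableT_comp (mexp t) mS).
have iSexp : P.-integrable setT (EFin \o (fun w => S w * expR (- (t * S w)))).
  apply: (@integrable_le _ _ _ P _ S) => //.
  - by apply: measurable_funM => //; exact: (measurableT_comp (mexp t) mS).
  - exact: integrable_S.
  by move=> w; rewrite normrM ger0_norm// ler_piMr// exp_le1.
have splitE : (fun w => (S w - m) * expR (- (t * S w))) =
    (fun w => S w * expR (- (t * S w)) - m * expR (- (t * S w))).
  by apply/funext => w; rewrite mulrBl.
have iexpk k : PQ.-integrable setT (EFin \o (fun z => expR (- (t * shifted k z)))).
  apply: (@integrable_bounded _ _ _ PQ _ 1) => [|z]; last exact: exp_le1.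
  exact: (measurableT_comp (mexp t) (measurable_shifted k)).
split.
- by rewrite splitE; apply: integrableB_EFin => //; exact: integrableZ_EFin.
- by move=> k; exact: integrableZ_EFin.
rewrite splitE RintegralB//; last exact: integrableZ_EFin.
rewrite RintegralZl//.
have mixed k : \int[PQ]_z expR (- (t * shifted k z)) = L t * (1 + 2 * (t * lam k))^-1.
  rewrite (@Rfubini_prod _ _ _ _ _ P Q (fun z => expR (- (t * shifted k z))) 1); last 2 first.
  - exact: (measurableT_comp (mexp t) (measurable_shifted k)).
  - by move=> z; exact: exp_le1.
  rewrite /L -RintegralZr//; apply: eq_Rintegral => w _.
  rewrite -laplace_chi ?mulr_ge0// -RintegralZl//; last first.
    apply: (@integrable_bounded _ _ _ Q _ 1) => [|e]; last by apply: exp_le1 => //; exact: mulr_ge0.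
    exact: (measurableT_comp (mexp _) mchi).
  by apply: eq_Rintegral => e _; rewrite -expRD /shifted/=; congr expR; ring.
move: t0; rewrite le_eqVlt => /predU1P[<-|t0].
  under eq_Rintegral do rewrite mul0r oppr0 expR0 mulr1.
  under [X in _ - _ * X]eq_Rintegral do rewrite mul0r oppr0 expR0.
  rewrite ES Rintegral_prob_cst mulr1 subrr big1// => k _.
  under eq_Rintegral do rewrite oppr0 mul0r.
  by rewrite Rintegral_prob_cst mulr0.
rewrite laplace_moment// -/(L t) /m -mulrBl -sumrB mulr_suml; apply: eq_bigr => k _.
rewrite RintegralZl// mixed.
by field; rewrite gt_eqF// one_plus_gt0// ltW.
Qed.

Lemma zero_biasedZ (a : R) F F' : zero_biased F F' ->
  zero_biased (fun x => a * F x) (fun x => a * F' x).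
Proof.
move=> [iF iF' E1]; have aE : (fun w => (S w - m) * (a * F (S w))) =
    (fun w => a * ((S w - m) * F (S w))) by apply/funext => w; ring.
split.
- by rewrite aE; exact: integrableZ_EFin.
- by move=> k; apply: integrableZ_EFin; exact: iF'.
rewrite aE RintegralZl// E1 mulr_sumr; apply: eq_bigr => k _.
by rewrite RintegralZl//; ring.
Qed.

Lemma zero_biasedD F F' G G' : zero_biased F F' -> zero_biased G G' ->
  zero_biased (fun x => F x + G x) (fun x => F' x + G' x).
Proof.
move=> [iF iF' E1] [iG iG' E2].
have aE : (fun w => (S w - m) * (F (S w) + G (S w))) =
    (fun w => (S w - m) * F (S w) + (S w - m) * G (S w)) by apply/funext => w; ring.
split.
- by rewrite aE; exact: integrableD_EFin.
- by move=> k; apply: integrableD_EFin; [exact: iF'|exact: iG'].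
rewrite aE RintegralD// E1 E2 -big_split; apply: eq_bigr => k _ /=.
by rewrite RintegralD//; ring.
Qed.

Lemma zero_biased_exp_sum (N : nat) (a : nat -> R) : zero_biased
  (fun x => \sum_(i < N) a i * expR (- (i%:R * x)))
  (fun x => \sum_(i < N) a i * (- i%:R * expR (- (i%:R * x)))).
Proof.
elim: N => [|N IH].
  have := zero_biasedZ 0 (zero_biased_exp (lexx 0)).
  congr zero_biased; apply/funext => x; by rewrite big_ord0 mul0r.
have := zero_biasedD IH (zero_biasedZ (a N) (zero_biased_exp (ler0n _ N))).
by congr zero_biased; apply/funext => x; rewrite big_ord_recr.
Qed.


(** Exponential polynomials approximate [f] and [f'] on the half-line, where
    [S] and its shifts live, and dominated convergence passes the identity to
    the limit.  The dominating function [|S - m| (|f 0| + M S)] is why a second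
    moment of [S] is needed. *)
Lemma gamma_zero_bias (f f' : R -> R) (M : R) :
  (forall x : R, is_derive x 1 f (f' x)) -> continuous f' ->
  (forall x, `|f' x| <= M) -> zero_biased f f'.
Proof.
move=> df cf' f'M.
have M0 : 0 <= M := le_trans (normr_ge0 _) (f'M 0).
have [sz [a [c /= [F'M FM F'cvg Fcvg]]]] := exp_poly_approximation df cf' f'M.
have zb N : zero_biased (fun x => c N + \sum_(i < sz N) a N i * expR (- (i%:R * x)))
    (fun x => \sum_(i < sz N) a N i * (- i%:R * expR (- (i%:R * x)))).
  have := zero_biasedD (zero_biasedZ (c N) (zero_biased_exp (lexx 0)))
     (zero_biased_exp_sum (sz N) (a N)).
  congr zero_biased; apply/funext => x; first by rewrite mul0r oppr0 expR0 mulr1.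
  by rewrite oppr0 mul0r mulr0 add0r.
have cf : continuous f.
  move=> x; apply: differentiable_continuous; apply/derivable1_diffP.
  by case: (df x).
have mf := continuous_measurable_fun cf.
have mf' := continuous_measurable_fun cf'.
have mSm : measurable_fun setT (fun w => S w - m) by exact: measurable_funB.
pose D w := `|S w - m| * (`|f 0| + M * S w).
have iD : P.-integrable setT (EFin \o D).
  pose K := 1 + `|m| * `|f 0| + (`|f 0| + `|m| * M) + M.
  have m0 := normr_ge0 m; have ff0 := normr_ge0 (f 0).
  apply: (@integrable_le _ _ _ P _ (fun w => K * (1 + S w + S w ^+ 2))) => //.
  - apply: measurable_funM; first exact: measurableT_comp.
    by apply: measurable_funD => //; exact: measurable_funM.
  - apply: integrableZ_EFin; apply: integrableD_EFin => //.
    apply: integrableD_EFin; last exact: integrable_S.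
    exact: finite_measure_integrable_cst.
  move=> w; rewrite /D ger0_norm ?mulr_ge0 ?addr_ge0// ?mulr_ge0//.
  have nb : `|S w - m| <= S w + `|m|.
    by rewrite (le_trans (ler_normB _ _))// ger0_norm.
  rewrite (@le_trans _ _ ((S w + `|m|) * (`|f 0| + M * S w)))//.
    by rewrite ler_wpM2r// addr_ge0// mulr_ge0.
  have Sw := S0 w.
  have h1 := mulr_ge0 m0 ff0; have h2 := mulr_ge0 m0 M0.
  have h3 := mulr_ge0 Sw Sw; have h4 := mulr_ge0 h1 Sw; have h5 := mulr_ge0 h2 Sw.
  have h6 := mulr_ge0 h1 h3; have h7 := mulr_ge0 h2 h3.
  have h8 := mulr_ge0 ff0 Sw; have h9 := mulr_ge0 M0 Sw.
  have h10 := mulr_ge0 ff0 h3; have h11 := mulr_ge0 M0 h3.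
  by rewrite /K; lra.
have iFf : P.-integrable setT (EFin \o (fun w => (S w - m) * f (S w))).
  apply: (@integrable_le _ _ _ P _ D) => //.
    by apply: measurable_funM => //; exact: measurableT_comp.
  move=> w; rewrite normrM ler_wpM2l//.
  have nf : `|c N + \sum_(i < sz N) a N i * expR (- (i%:R * S w))| @[N --> \oo] --> `|f (S w)|.
    by apply: cvg_norm; exact: Fcvg.
  by apply: (cvgr_to_le nf); apply: nearW => N; exact: FM.
have mshift k := measurableT_comp mf' (measurable_shifted k).
have if'k k : PQ.-integrable setT (EFin \o (fun z => f' (shifted k z))).
  apply: (@integrable_bounded _ _ _ PQ _ M) => //; exact: mshift.
split => //.
have lhs : \int[P]_w ((S w - m) *
      (c N + \sum_(i < sz N) a N i * expR (- (i%:R * S w)))) @[N --> \oo] -->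
    \int[P]_w ((S w - m) * f (S w)).
  apply: (@Rdominated_cvg _ _ _ P _ _ D) => //.
  - by move=> N; have [/measurable_int/measurable_EFinP] := zb N.
  - by move=> w; apply: cvgM; [exact: cvg_cst|exact: Fcvg].
  - by move=> N w; rewrite normrM ler_wpM2l// FM.
have rhs : \sum_(k < n) 2 * lam k ^+ 2 * \int[PQ]_z
      (\sum_(i < sz N) a N i * (- i%:R * expR (- (i%:R * shifted k z)))) @[N --> \oo] -->
    \sum_(k < n) 2 * lam k ^+ 2 * \int[PQ]_z f' (shifted k z).
  apply: cvg_big => [|k _]; first exact: add_continuous.
  apply: cvgM; first exact: cvg_cst.
  apply: (@Rdominated_cvg _ _ _ PQ _ _ (cst M)) => //.
  - by move=> N; have [_ /(_ k)/measurable_int/measurable_EFinP] := zb N.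
  - by move=> z; exact: F'cvg.
  - exact: finite_measure_integrable_cst.
  - by move=> N z; exact: F'M.
have lhs' : \sum_(k < n) 2 * lam k ^+ 2 * \int[PQ]_z
      (\sum_(i < sz N) a N i * (- i%:R * expR (- (i%:R * shifted k z)))) @[N --> \oo] -->
    \int[P]_w ((S w - m) * f (S w)).
  apply: cvg_trans lhs; apply: near_eq_cvg; apply: nearW => N.
  by have [_ _ ->] := zb N.
exact: (cvg_unique _ lhs' rhs).
Qed.

(** The zero-bias identity for [f = id]. *)
Lemma gamma_variance : \int[P]_w ((S w - m) ^+ 2) = 2 * \sum_(k < n) lam k ^+ 2.
Proof.
have [iS _ E1] : zero_biased id (cst 1).
  apply: (@gamma_zero_bias _ _ 1) => //.
  - by move=> x; exact: cvg_cst.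
  - by move=> x; rewrite normr1.
have iSm : P.-integrable setT (EFin \o (fun w => S w - m)).
  by apply: integrableB_EFin; [exact: integrable_S|exact: finite_measure_integrable_cst].
under eq_Rintegral do rewrite expr2 mulrBr.
rewrite RintegralB//; last first.
  rewrite (_ : (fun w => _) = (fun w => m * (S w - m))); last by apply/funext => w; rewrite mulrC.
  exact: integrableZ_EFin.
rewrite E1 RintegralZr// RintegralB//; [|exact: integrable_S|exact: finite_measure_integrable_cst].
rewrite ES Rintegral_prob_cst subrr mul0r subr0 mulr_sumr.
by apply: eq_bigr => k _; rewrite Rintegral_prob_cst mulr1.
Qed.

End gamma_zero_bias.

(** * Stein's equation *)

Section stein_equation.
Context (R : realType).
Local Notation mu := (@lebesgue_measure R).
Local Notation pdf := (@normal_pdf R 0 1).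

Let one0 : (1 : R) != 0 := oner_neq0 _.

Let cpdf : continuous pdf. Proof. exact: continuous_normal_pdf. Qed.

Let dpdf (x : R) : is_derive x 1 pdf (- x * pdf x).
Proof.
by have := is_derive_normal_pdf 0 one0 x; rewrite subr0 expr1n divr1.
Qed.

Let pdf_gt0 (x : R) : 0 < pdf x.
Proof. by rewrite normal_pdfE// mulr_gt0 ?normal_peak_gt0 ?expR_gt0. Qed.

Let pdfN (x : R) : pdf (- x) = pdf x.
Proof. by rewrite !normal_pdfE// /normal_fun !subr0 sqrrN. Qed.

Let pdf_cvg0 : pdf x @[x --> +oo] --> (0 : R).
Proof.
have -> : pdf = fun x => normal_peak 1 * expR (- (x ^+ 2 / 2)).
  apply/funext => x; rewrite normal_pdfE// /normal_fun subr0 expr1n.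
  by congr (_ * expR _); rewrite mulNr.
rewrite -[X in _ --> X](mulr0 (normal_peak 1)).
apply: cvgM; first exact: cvg_cst.
apply: (@cvg_comp _ _ _ (fun x : R => x ^+ 2 / 2) (fun x => expR (- x)) _ (pinfty_nbhs R)).
  by apply: gt0_cvgMly; [rewrite invr_gt0|exact: cvgr_expr2].
exact: cvgr_expR.
Qed.

Let mpdf : measurable_fun setT pdf. Proof. exact: measurable_normal_pdf. Qed.

Let ixpdf : mu.-integrable setT (EFin \o (fun y => y * pdf y)).
Proof.
apply: (@integrable_poly_pdf R 0 1 one0 _ 1 1) => // x.
by rewrite subr0 mul1r lerDr.
Qed.

(** [- pdf] is an antiderivative of [y * pdf y]. *)
Lemma upper_first_moment (x : R) : 0 <= x ->
  \int[mu]_(y in `[x, +oo[) (y * pdf y) = pdf x.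
Proof.
move=> x0; rewrite (@Rintegral_ge0_continuous_FTC2y _ _ (fun y => - pdf y) _ 0)//.
- by rewrite sub0r opprK.
- by move=> y xy; rewrite mulr_ge0 ?normal_pdf_ge0// (le_trans x0).
- apply: continuous_subspaceT => y; apply: cvgM; [exact: cvg_id|exact: cpdf].
- by rewrite -[X in _ --> X]oppr0; apply: cvgN; exact: pdf_cvg0.
- by move=> y _; apply: derivableN; case: (dpdf y).
- by apply: cvg_at_right_filter; apply: cvgN; exact: cpdf.
- move=> y _; rewrite derive1E; have dy := dpdf y.
  by rewrite derive_val mulNr opprK.
Qed.

(** On the tail [x <= y], so that the constant [x] may be replaced by [y], for
    which the integral is explicit (Mills' ratio). *)
Lemma upper_tail_bound (q : R -> R) (B x : R) : measurable_fun setT q ->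
  (forall y, `|q y| <= B * pdf y) -> 0 <= x ->
  x * `|\int[mu]_(y in `[x, +oo[) q y| <= B * pdf x.
Proof.
move=> mq qB x0.
have mI : measurable (`[x, +oo[%classic : set R) by exact: measurable_itv.
have iq : mu.-integrable setT (EFin \o q).
  apply: (@integrable_le _ _ _ mu _ (fun y => B * pdf y)) => //.
  by apply: integrableZ_EFin; exact: integrable_normal_pdf.
have iqI : mu.-integrable `[x, +oo[ (EFin \o q) by exact: integrableS iq.
have iqn : mu.-integrable setT (EFin \o (fun y => `|q y|)).
  rewrite (_ : EFin \o _ = (abse \o (EFin \o q)))//.
  exact: integrable_abse.
rewrite (@le_trans _ _ (x * \int[mu]_(y in `[x, +oo[) `|q y|))//.
  by rewrite ler_wpM2l// le_normr_Rintegral.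
have iqIn : mu.-integrable `[x, +oo[ (EFin \o (fun y => `|q y|)) by exact: integrableS iqn.
rewrite -RintegralZl// -(upper_first_moment x0) -RintegralZl//; last first.
  exact: integrableS ixpdf.
apply: le_Rintegral => //.
- apply: (integrableS measurableT) => //; exact: (integrableZ_EFin x iqn).
- apply: (integrableS measurableT) => //; exact: (integrableZ_EFin B ixpdf).
move=> y /=; rewrite in_itv/= andbT => xy.
rewrite mulrCA; apply: ler_pM => //.
Qed.

Lemma lower_tail_bound (q : R -> R) (B x : R) : continuous q ->
  (forall y, `|q y| <= B * pdf y) -> 0 <= x ->
  x * `|\int[mu]_(y in `]-oo, (- x)]) q y| <= B * pdf x.
Proof.
move=> cq qB x0; have mq := continuous_measurable_fun cq.
have mI : measurable (`]-oo, (- x)]%classic : set R) by exact: measurable_itv.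
have iq : mu.-integrable setT (EFin \o q).
  apply: (@integrable_le _ _ _ mu _ (fun y => B * pdf y)) => //.
  by apply: integrableZ_EFin; exact: integrable_normal_pdf.
have iqI : mu.-integrable `]-oo, (- x)] (EFin \o q) by exact: integrableS iq.
rewrite (@le_trans _ _ (x * \int[mu]_(y in `]-oo, (- x)]) `|q y|))//.
  by rewrite ler_wpM2l// le_normr_Rintegral.
have -> : \int[mu]_(y in `]-oo, (- x)]) `|q y| = \int[mu]_(y in `[x, +oo[) `|q (- y)|.
  rewrite /Rintegral; congr fine.
  apply: (@ge0_integration_by_substitutionNy _ (fun y => `|q y|)) => //.
  by apply: continuous_subspaceT => y; apply: cvg_norm; exact: cq.
have B0 : 0 <= B by have := le_trans (normr_ge0 _) (qB 0); rewrite pmulr_lge0.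
have qN (y : R) : `| `|q (- y)| | <= B * pdf y by rewrite normr_id -[pdf y]pdfN.
have mqN : measurable_fun setT (fun y : R => `|q (- y)|).
  by apply: measurableT_comp => //; exact: measurableT_comp.
have := upper_tail_bound mqN qN x0.
by rewrite ger0_norm// Rintegral_ge0.
Qed.

(** The solution is [f = J / pdf], where [J x] is the integral of
    [(h - c) * pdf] over the half-line up to [x].  Since the full integral of
    [(h - c) * pdf] vanishes, [J] is also minus an upper tail, and the tail
    bounds on either side show that [x * f x] is bounded, hence [f'] too. *)
Lemma stein_solution (h : R -> R) (M : R) : continuous h -> (forall x, `|h x| <= M) ->
  exists f f' : R -> R, [/\ forall x : R, is_derive x 1 f (f' x), continuous f',
    forall x, `|f' x| <= 4 * M &
    forall x, f' x = x * f x + (h x - \int[@normal_prob R 0 1]_y h y)].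
Proof.
move=> ch hM; pose c := \int[@normal_prob R 0 1]_y h y; rewrite -/c.
have M0 : 0 <= M := le_trans (normr_ge0 _) (hM 0).
have mh := continuous_measurable_fun ch.
have [ih cE] : (@normal_prob R 0 1).-integrable setT (EFin \o h) /\
    c = \int[mu]_y (h y * pdf y).
  by apply: (@integrable_poly_normal R 0 1 one0 h M 0 mh) => x; rewrite expr0 mulr1.
have cM : `|c| <= M.
  rewrite /c (le_trans (le_normr_Rintegral _ _))//.
  rewrite -[leRHS](Rintegral_prob_cst (@normal_prob R 0 1)).
  apply: le_Rintegral => //.
  - by rewrite (_ : EFin \o _ = (abse \o (EFin \o h)))//; exact: integrable_abse.
  - exact: (@integrable_bounded _ _ _ (@normal_prob R 0 1) _ `|M|).
pose q (y : R) := (h y - c) * pdf y.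
have cq : continuous q.
  move=> y; apply: cvgM; last exact: cpdf.
  by apply: cvgB; [exact: ch|exact: cvg_cst].
have mq := continuous_measurable_fun cq.
have qB (y : R) : `|q y| <= 2 * M * pdf y.
  rewrite normrM (ger0_norm (normal_pdf_ge0 _ _ _)) ler_wpM2r ?normal_pdf_ge0//.
  by have := ler_normB (h y) c; have := hM y; move: cM; lra.
have iq : mu.-integrable setT (EFin \o q).
  apply: (@integrable_le _ _ _ mu _ (fun y => 2 * M * pdf y)) => //.
  by apply: integrableZ_EFin; exact: integrable_normal_pdf.
have q0 : \int[mu]_y q y = 0.
  rewrite /q; under eq_Rintegral do rewrite mulrBl.
  rewrite RintegralB//; last 2 first.
  - by apply: (@integrable_poly_pdf R 0 1 one0 h M 0) => // x; rewrite expr0 mulr1.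
  - by apply: integrableZ_EFin; exact: integrable_normal_pdf.
  rewrite RintegralZl//; last exact: integrable_normal_pdf.
  by rewrite -cE /Rintegral integral_normal_pdf mulr1 subrr.
pose J (x : R) := \int[mu]_(y in `]-oo, x]) q y.
have dJ (x : R) : is_derive x 1 J (q x).
  have x1 : x < x + 1 by rewrite ltrDl.
  have iqx : mu.-integrable [set` Interval -oo%O (BRight (x + 1))] (EFin \o q).
    by apply: (integrableS measurableT) => //; exact: measurable_itv.
  have [d1 d2] := @continuous_FTC1 R q -oo%O x (x + 1) x1 iqx (ltNyr _) (cq x).
  by apply: DeriveDef; [exact: d1|rewrite -derive1E].
have JE (x : R) : J x = - \int[mu]_(y in `[x, +oo[) q y.
  apply/eqP; rewrite -addr_eq0 -q0 eq_sym; apply/eqP.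
  rewrite -(@itv_setU_setT _ R false x) Rintegral_setU.
  - congr (_ + _); apply: Rintegral_itv_obnd_cbnd.
    by apply: (integrableS measurableT) => //; exact: measurable_itv.
  - exact: measurable_itv.
  - exact: measurable_itv.
  - by apply: (integrableS measurableT) => //; rewrite itv_setU_setT.
  - exact: disjoint_rays.
pose f x := J x / pdf x.
pose f' x := x * f x + (h x - c).
have xf (x : R) : `|x * f x| <= 2 * M.
  rewrite /f mulrA normrM normfV (ger0_norm (ltW (pdf_gt0 x))) ler_pdivrMr//.
  rewrite normrM; have [x0|x0] := leP 0 x.
    by rewrite JE normrN (ger0_norm x0); exact: upper_tail_bound.
  rewrite (ltr0_norm x0) -[pdf x]pdfN -{2}(opprK x).
  by apply: lower_tail_bound => //; rewrite oppr_ge0 ltW.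
have df (x : R) : is_derive x 1 f (f' x).
  have dx := dJ x; have dp := dpdf x; have pn0 := pdf_gt0 x.
  have dV : is_derive x 1 (fun x => (pdf x)^-1) (- pdf x ^- 2 * (- x * pdf x)).
    by apply: is_deriveV; rewrite gt_eqF.
  have -> : f = J * (fun x => (pdf x)^-1) by [].
  apply: is_derive_eq; rewrite /f' /f /GRing.scale/= /q.
  by field; rewrite gt_eqF.
exists f, f'; split => //.
- move=> x; apply: cvgD; last by apply: cvgB; [exact: ch|exact: cvg_cst].
  apply: cvgM; first exact: cvg_id.
  apply: differentiable_continuous; apply/derivable1_diffP.
  by case: (df x).
- move=> x; rewrite /f' (le_trans (ler_normD _ _))//.
  have := xf x; have := ler_normB (h x) c; have := hM x; move: cM; lra.
Qed.

End stein_equation.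

(** * A modulus of continuity on the whole line *)

Lemma uniform_continuity_segment (R : realType) (g : R -> R) (a b e : R) :
  continuous g -> 0 < e ->
  exists2 r : R, 0 < r & forall x y : R, a <= x <= b -> `|x - y| < r -> `|g x - g y| <= e.
Proof.
move=> cg e0; have e20 : 0 < e / 2 by rewrite divr_gt0.
have /compact_near_coveringP cov := @segment_compact R a b.
have cov_loc (x : R) : (`[a, b]%classic : set R) x ->
    \forall x' \near x & r \near 0^'+, forall y, `|x' - y| < r -> `|g x' - g y| <= e.
  move=> _; have /cvgrPdist_le/(_ _ e20)/nbhs_ballP[r /= r0 gr] := cg x.
  have r20 : 0 < r / 2 by rewrite divr_gt0.
  exists (ball x (r / 2), [set s : R | s < r / 2]).
    split => /=; first exact: nbhsx_ballx.
    exact: nbhs_right_lt.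
  move=> [z s] /= [xz sr] y zy.
  rewrite /ball/= in xz gr.
  have h1 := gr z; have h2 := gr y.
  have xz' : `|x - z| < r by rewrite (lt_trans xz)//; lra.
  have xy' : `|x - y| < r.
    have := ler_distD z x y; have := lt_trans zy sr; move: xz; lra.
  have := ler_distD (g x) (g z) (g y); rewrite (distrC (g z) (g x)).
  by have := h1 xz'; have := h2 xy'; lra.
have near0 := cov R (0^'+) (fun r x => forall y, `|x - y| < r -> `|g x - g y| <= e) _ cov_loc.
have [r [r0 gr]] : exists r : R, 0 < r /\
    (`[a, b]%classic `<=` (fun x => forall y, `|x - y| < r -> `|g x - g y| <= e)).
  near (0 : R)^'+ => r; exists r; split; first by near: r; exact: nbhs_right_gt.
  near: r; exact: near0.
exists r => // x y xab; apply: gr.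
by rewrite /= in_itv.
Unshelve. all: by end_near. Qed.

(** A bounded continuous function need not be uniformly continuous on the line:
    the term [x ^+ 2] absorbs large [x], the term [C * v] large shifts, and
    Heine's theorem does the rest. *)
Lemma continuous_bounded_modulus (R : realType) (g : R -> R) (B e : R) :
  continuous g -> (forall x, `|g x| <= B) -> 0 < e ->
  exists2 C : R, 0 <= C &
    forall x v : R, 0 <= v -> `|g x - g (x + v)| <= e * (1 + x ^+ 2) + C * v.
Proof.
move=> cg gB e0; have B0 : 0 <= B := le_trans (normr_ge0 _) (gB 0).
have g2B (x y : R) : `|g x - g y| <= 2 * B.
  by have := ler_normB (g x) (g y); have := gB x; have := gB y; lra.
(* Beyond [K] the crude bound [2 * B] is below [e * x ^+ 2]. *)
pose K := 1 + 2 * B / e.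
have K1 : 1 <= K by rewrite lerDl divr_ge0// ?mulr_ge0// ltW.
have eK : 2 * B <= e * K by rewrite /K mulrDr mulr1 mulrCA divff ?gt_eqF// mulr1 lerDr ltW.
have [r r0 gr] := @uniform_continuity_segment R g (- K) K e cg e0.
exists (2 * B / r) => [|x v v0]; first by rewrite divr_ge0 ?mulr_ge0// ltW.
have Cv0 : 0 <= 2 * B / r * v by rewrite mulr_ge0// divr_ge0 ?mulr_ge0// ltW.
have ex0 : 0 <= e * x ^+ 2 by rewrite mulr_ge0 ?sqr_ge0// ltW.
have [xK|Kx] := leP `|x| K; last first.
  have : e * K <= e * x ^+ 2.
    rewrite ler_wpM2l ?(ltW e0)// -real_normK ?num_real//.
    by have := normr_ge0 x; nra.
  by have := g2B x (x + v); lra.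
have [vr|rv] := ltP v r.
  have := gr x (x + v); rewrite -ler_norml => /(_ xK).
  rewrite opprD addNKr normrN ger0_norm// => /(_ vr).
  lra.
have : 2 * B <= 2 * B / r * v by rewrite mulrAC ler_pdivlMr// ler_wpM2l// mulr_ge0.
by have := g2B x (x + v); lra.
Qed.

(** * The chi-square law with two degrees of freedom *)

Section chi_square.
Context (R : realType).
Local Notation gauss := (@normal_prob R 0 1).

Definition chi_square (z : measurableTypeR R * measurableTypeR R) : R :=
  (z.1 : R) ^+ 2 + (z.2 : R) ^+ 2.

Lemma measurable_chi_square : measurable_fun setT chi_square.
Proof.
by apply: measurable_funD; apply: measurable_funX;
  [exact: measurable_fst|exact: measurable_snd].
Qed.

Lemma chi_square_ge0 z : 0 <= chi_square z.
Proof. by rewrite addr_ge0 ?sqr_ge0. Qed.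

Let integrable_exp_sq (a : R) : 0 <= a ->
  gauss.-integrable setT (EFin \o (fun x : R => expR (- (a * x ^+ 2)))).
Proof.
move=> a0; apply: (@integrable_bounded _ _ _ gauss _ 1).
  apply: measurableT_comp => //; apply: measurableT_comp => //.
  by apply: measurable_funM => //; exact: measurable_funX.
by move=> x; rewrite ger0_norm ?expR_ge0// expR_le1 oppr_le0 mulr_ge0// sqr_ge0.
Qed.

(** Two degrees of freedom turn the inverse square root of the
    one-dimensional transform into an inverse, which is the factor appearing in
    the derivative of the Laplace transform of a quadratic form. *)
Lemma chi_square_laplace (a : R) : 0 <= a ->
  \int[(gauss \x gauss)%E]_z expR (- (a * chi_square z)) = (1 + 2 * a)^-1.
Proof.
move=> a0; rewrite (@Rfubini_prod _ _ _ _ _ gauss gauss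
  (fun z => expR (- (a * chi_square z))) 1); last 2 first.
- apply: measurableT_comp => //; apply: measurableT_comp => //.
  by apply: measurable_funM => //; exact: measurable_chi_square.
- move=> z; rewrite ger0_norm ?expR_ge0// expR_le1 oppr_le0 mulr_ge0//.
  exact: chi_square_ge0.
have a1 : 0 <= 1 + 2 * a by lra.
transitivity (\int[gauss]_x (expR (- (a * x ^+ 2)) * (Num.sqrt (1 + 2 * a))^-1)).
  apply: eq_Rintegral => x _; rewrite -(normal_square_laplace a0) -RintegralZl//; last first.
    exact: integrable_exp_sq.
  apply: eq_Rintegral => y _; rewrite -expRD /chi_square/=.
  by congr expR; ring.
rewrite RintegralZr//; last exact: integrable_exp_sq.
by rewrite normal_square_laplace// -expr2 exprVn sqr_sqrtr.
Qed.

Let isq : gauss.-integrable setT (EFin \o (fun x : R => x ^+ 2)).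
Proof.
apply: (proj1 (@integrable_poly_normal R 0 1 (oner_neq0 _) _ 1 2 _ _)).
  exact: measurable_funX.
by move=> x; rewrite subr0 mul1r normrX lerXn2r ?nnegrE ?addr_ge0// lerDr.
Qed.

Let sqE : \int[gauss]_x (x ^+ 2) = 1.
Proof.
apply: etrans (etrans (@normal_variance R 0 1 (oner_neq0 _)) (expr1n _ _)).
by apply: eq_Rintegral => x _; rewrite subr0.
Qed.

Let inner (x : R) : (\int[gauss]_y (chi_square (x, y))%:E)%E = (x ^+ 2 + 1)%:E.
Proof.
have i2 : gauss.-integrable setT (EFin \o (fun y => chi_square (x, y))).
  apply: (@integrableD_EFin _ _ _ gauss (cst (x ^+ 2)) _ _ isq).
  exact: finite_measure_integrable_cst.
rewrite -[LHS]fineK ?integrable_fin_num//; congr _%:E.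
rewrite -[LHS]/(\int[gauss]_y (x ^+ 2 + y ^+ 2)) RintegralD//; last first.
  exact: finite_measure_integrable_cst.
by rewrite Rintegral_prob_cst sqE.
Qed.

Let outer : (\int[gauss]_x (x ^+ 2 + 1)%:E = 2%:E)%E.
Proof.
have i2 : gauss.-integrable setT (EFin \o (fun x : R => x ^+ 2 + 1)).
  apply: (@integrableD_EFin _ _ _ gauss _ (cst 1) isq).
  exact: finite_measure_integrable_cst.
rewrite -[LHS]fineK ?integrable_fin_num//; congr _%:E.
rewrite -[LHS]/(\int[gauss]_x (x ^+ 2 + 1)) RintegralD//; last first.
  exact: finite_measure_integrable_cst.
by rewrite Rintegral_prob_cst sqE.
Qed.

Lemma integrable_chi_square :
  (gauss \x gauss)%E.-integrable setT (EFin \o chi_square).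
Proof.
apply/integrable12ltyP; first by apply/measurable_EFinP; exact: measurable_chi_square.
rewrite (_ : (\int[_]_x _)%E = 2%:E) ?ltry// -outer.
apply: eq_integral => x _; rewrite -inner; apply: eq_integral => y _.
by rewrite /= ger0_norm// chi_square_ge0.
Qed.

Lemma chi_square_mean : \int[(gauss \x gauss)%E]_z chi_square z = 2.
Proof.
rewrite /Rintegral -(integral12_prod_meas1 integrable_chi_square) /fubini_F.
by under eq_integral do rewrite inner; rewrite outer.
Qed.

End chi_square.

(** * Bounds for the standardised quadratic form *)

(** The derivative of [(1 + x) * expR (- p x)] is
    [expR (- p x) * x^2 * (2 - x) / 3], non-negative up to [2].  The cubic term
    is what detects a non-Gaussian limit. *)
Lemma expR_cubic_le (R : realType) (y : R) : 0 <= y <= 2 ->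
  expR (y - y ^+ 2 / 2 + y ^+ 3 / 9) <= 1 + y.
Proof.
move=> /andP[y0 y2]; pose p (x : R) := x - x ^+ 2 / 2 + x ^+ 3 / 9.
pose phi (x : R) := (1 + x) * expR (- p x).
have dphi (x : R) : is_derive x 1 phi (expR (- p x) * (x ^+ 2 * (2 - x) / 3)).
  have dp : is_derive x 1 p (1 - x + x ^+ 2 / 3).
    by apply: is_derive_eq; rewrite /GRing.scale/=; field.
  by apply: is_derive_eq; rewrite /GRing.scale/=; field.
have cphi : continuous phi.
  move=> x; apply: differentiable_continuous; apply/derivable1_diffP.
  by case: (dphi x).
have : phi 0 <= phi y.
  apply: (@ger0_derive1_ndecr R phi 0 2) => //.
  - move=> x; rewrite in_itv/= => /andP[x0 x2].
    rewrite derive1E; have dx := dphi x; rewrite derive_val.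
    by rewrite !mulr_ge0 ?expR_ge0 ?sqr_ge0 ?subr_ge0 ?invr_ge0// ltW.
  - exact: continuous_subspaceT.
have -> : phi 0 = 1 by rewrite /phi /p (_ : - _ = 0) ?expR0; ring.
by rewrite /phi expRN ler_pdivlMr ?expR_gt0// mul1r.
Qed.

(** Up to integrability, this says that [S] has the law of the sum of
    [lam k * N_k ^+ 2] over independent standard Gaussian [N_k]: the Laplace
    transform is the only description of that law which is used. *)
Record gamma_law d (T : measurableType d) (R : realType) (P : probability T R)
    (n : nat) (lam : 'I_n -> R) (S : T -> R) : Prop := GammaLaw {
  gl_lam_ge0 : forall k, 0 <= lam k;
  gl_measurable : measurable_fun setT S;
  gl_ge0 : forall w, 0 <= S w;
  gl_integrable2 : P.-integrable setT (EFin \o (fun w => S w ^+ 2));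
  gl_mean : \int[P]_w S w = \sum_(k < n) lam k;
  gl_laplace : forall t : R, 0 <= t -> \int[P]_w expR (- (t * S w)) =
    \prod_(k < n) (Num.sqrt (1 + 2 * (t * lam k)))^-1 }.

Section standardised.
Context d (T : measurableType d) (R : realType) (P : probability T R).
Variables (n : nat) (lam : 'I_n -> R) (S : T -> R).
Hypothesis HS : gamma_law P lam S.
Hypothesis lam_gt0 : 0 < \sum_(k < n) lam k ^+ 2.

Local Notation gauss := (@normal_prob R 0 1).
Let m := \sum_(k < n) lam k.
Let sigma := Num.sqrt (2 * \sum_(k < n) lam k ^+ 2).
Let mu k := lam k / sigma.
Let W w := (S w - m) / sigma.

Let sigma2 : sigma ^+ 2 = 2 * \sum_(k < n) lam k ^+ 2.
Proof. by rewrite sqr_sqrtr// mulr_ge0// ltW. Qed.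

Let sigma_gt0 : 0 < sigma. Proof. by rewrite sqrtr_gt0 mulr_gt0. Qed.
Let sigma_neq0 : sigma != 0. Proof. by rewrite gt_eqF. Qed.

Let mu_ge0 k : 0 <= mu k.
Proof. by rewrite divr_ge0 ?(gl_lam_ge0 HS)// ltW. Qed.

Let sum_mu2 : \sum_(k < n) mu k ^+ 2 = 1 / 2.
Proof.
rewrite (eq_bigr (fun k => lam k ^+ 2 * sigma ^- 2)); last first.
  by move=> k _; rewrite /mu exprMn exprVn.
by rewrite -mulr_suml sigma2; field; rewrite gt_eqF.
Qed.

Let sum_weights : \sum_(k < n) 2 * mu k ^+ 2 = 1.
Proof. by rewrite -mulr_sumr sum_mu2 mulrA mulr1 divff. Qed.

Let mW : measurable_fun setT W.
Proof.
apply: measurable_funM => //; apply: measurable_funB => //; exact: (gl_measurable HS).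
Qed.

Let iS : P.-integrable setT (EFin \o S).
Proof. exact: (integrable_S (gl_measurable HS) (gl_ge0 HS) (gl_integrable2 HS)). Qed.

Let iW2 : P.-integrable setT (EFin \o (fun w => W w ^+ 2)).
Proof.
have -> : (fun w => W w ^+ 2) = (fun w => sigma ^- 2 *
    (S w ^+ 2 + (- 2 * m * S w + m ^+ 2))).
  by apply/funext => w; rewrite /W; field.
apply: integrableZ_EFin; apply: integrableD_EFin; first exact: (gl_integrable2 HS).
apply: integrableD_EFin; first exact: integrableZ_EFin.
exact: finite_measure_integrable_cst.
Qed.

Lemma standardised_variance : \int[P]_w (W w ^+ 2) = 1.
Proof.
have V := gamma_variance (gl_lam_ge0 HS) (gl_measurable HS) (gl_ge0 HS)
  (gl_integrable2 HS) (gl_mean HS) (gl_laplace HS) (@measurable_chi_square R)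
  (@chi_square_ge0 R) (@chi_square_laplace R).
have -> : \int[P]_w (W w ^+ 2) = \int[P]_w (sigma ^- 2 * (S w - m) ^+ 2).
  by apply: eq_Rintegral => w _; rewrite /W exprMn exprVn mulrC.
rewrite RintegralZl//; last first.
  have -> : (fun w => (S w - m) ^+ 2) = (fun w => sigma ^+ 2 * W w ^+ 2).
    by apply/funext => w; rewrite /W; field.
  exact: integrableZ_EFin.
by rewrite V -sigma2 mulVf// expf_neq0.
Qed.

Let gauss2 : probability (measurableTypeR R * measurableTypeR R)%type R :=
  (gauss \x gauss)%E.
Let joint : probability (T * (measurableTypeR R * measurableTypeR R))%type R :=
  (P \x gauss2)%E.

Let shift k (z : measurableTypeR R * measurableTypeR R) := mu k * chi_square z.

Lemma standardised_zero_bias (f f' : R -> R) (B : R) :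
  (forall x : R, is_derive x 1 f (f' x)) -> continuous f' ->
  (forall x, `|f' x| <= B) ->
  P.-integrable setT (EFin \o (fun w => W w * f (W w))) /\
  \int[P]_w (W w * f (W w)) = \sum_(k < n) 2 * mu k ^+ 2 *
    \int[P]_w \int[gauss2]_z f' (W w + shift k z).
Proof.
move=> df cf' f'B.
pose st (s : R) := (s - m) / sigma.
have dF (x : R) : is_derive x 1 (f \o st) (f' (st x) / sigma).
  have ds : is_derive x 1 st sigma^-1.
    by apply: is_derive_eq; rewrite /GRing.scale/=; ring.
  have := df (st x) => dfx.
  exact: is_derive1_comp.
have cst_ : continuous st.
  move=> x; apply: cvgM; last exact: cvg_cst.
  by apply: cvgB; [exact: cvg_id|exact: cvg_cst].
have cF' : continuous (fun x => f' (st x) / sigma).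
  move=> x; apply: cvgM; last exact: cvg_cst.
  by apply: continuous_comp; [exact: cst_|exact: cf'].
have F'B x : `|f' (st x) / sigma| <= B / sigma.
  by rewrite normrM normfV (gtr0_norm sigma_gt0) ler_pM2r ?invr_gt0.
have [i1 _ E1] := gamma_zero_bias (gl_lam_ge0 HS) (gl_measurable HS) (gl_ge0 HS)
  (gl_integrable2 HS) (gl_mean HS) (gl_laplace HS) (@measurable_chi_square R)
  (@chi_square_ge0 R) (@chi_square_laplace R) dF cF' F'B.
have WE : (fun w => W w * f (W w)) = (fun w => sigma^-1 * ((S w - m) * (f \o st) (S w))).
  by apply/funext => w; rewrite /W /= /st; ring.
split; first by rewrite WE; exact: integrableZ_EFin.
rewrite WE RintegralZl// E1 mulr_sumr; apply: eq_bigr => k _.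
have mf' := continuous_measurable_fun cf'.
have mshift : measurable_fun setT
    (fun z : T * (measurableTypeR R * measurableTypeR R) => W z.1 + shift k z.2).
  apply: measurable_funD; first exact: measurableT_comp.
  apply: measurable_funM => //.
  by apply: measurableT_comp => //; exact: measurable_chi_square.
have -> : \int[joint]_z (f' (st (S z.1 + lam k * chi_square z.2)) / sigma) =
    sigma^-1 * \int[P]_w \int[gauss2]_z f' (W w + shift k z).
  rewrite -(@Rfubini_prod _ _ _ _ _ P gauss2 (fun z => f' (W z.1 + shift k z.2)) B); last 2 first.
  - exact: (measurableT_comp mf' mshift).
  - by move=> z; exact: f'B.
  rewrite -RintegralZl//; last first.
    apply: (@integrable_bounded _ _ _ joint _ B) => //.
    exact: (measurableT_comp mf' mshift).
  apply: eq_Rintegral => z _; rewrite mulrC; congr (_ * f' _).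
  by rewrite /st /W /shift /mu; ring.
by rewrite /mu; field.
Qed.


(** The modulus of continuity is integrated; [W] has second moment [1] and
    [chi_square] has mean [2]. *)
Lemma shift_bound (g : R -> R) (B e C : R) k :
  continuous g -> (forall x, `|g x| <= B) -> 0 <= C ->
  (forall x v : R, 0 <= v -> `|g x - g (x + v)| <= e * (1 + x ^+ 2) + C * v) ->
  `|\int[P]_w g (W w) - \int[P]_w \int[gauss2]_z g (W w + shift k z)|
     <= 2 * e + 2 * C * mu k.
Proof.
move=> cg gB C0 gmod; have mg := continuous_measurable_fun cg.
have mshift : measurable_fun setT
    (fun z : T * (measurableTypeR R * measurableTypeR R) => W z.1 + shift k z.2).
  apply: measurable_funD; first exact: measurableT_comp.
  apply: measurable_funM => //.
  by apply: measurableT_comp => //; exact: measurable_chi_square.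
have iJ := @integrable_section _ _ _ _ _ P gauss2 (fun z => g (W z.1 + shift k z.2)) B
  (measurableT_comp mg mshift) (fun z => gB _).
have igW : P.-integrable setT (EFin \o (fun w => g (W w))).
  by apply: (@integrable_bounded _ _ _ P _ B) => //; exact: measurableT_comp.
have ibnd : P.-integrable setT (EFin \o (fun w => e * (1 + W w ^+ 2) + 2 * C * mu k)).
  apply: integrableD_EFin; last exact: finite_measure_integrable_cst.
  apply: integrableZ_EFin; apply: integrableD_EFin => //.
  exact: finite_measure_integrable_cst.
rewrite -RintegralB// (le_trans (le_normr_Rintegral _ _))//; first exact: integrableB_EFin.
apply: (@le_trans _ _ (\int[P]_w (e * (1 + W w ^+ 2) + 2 * C * mu k))).
  apply: le_Rintegral => //.
    rewrite (_ : EFin \o _ = (abse \o (EFin \o (fun w => g (W w) -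
      \int[gauss2]_z g (W w + shift k z)))))//.
    by apply: integrable_abse; exact: integrableB_EFin.
  move=> w _.
  have msec : measurable_fun setT (fun z => g (W w + shift k z)).
    apply: measurableT_comp => //; apply: measurable_funD => //.
    by apply: measurable_funM => //; exact: measurable_chi_square.
  have igs : gauss2.-integrable setT (EFin \o (fun z => g (W w + shift k z))).
    exact: (@integrable_bounded _ _ _ gauss2 _ B).
  have icst : gauss2.-integrable setT (EFin \o (fun=> g (W w))).
    exact: finite_measure_integrable_cst.
  rewrite -{1}(Rintegral_prob_cst gauss2 (g (W w))) -RintegralB//.
  rewrite (le_trans (le_normr_Rintegral _ _))//; first exact: integrableB_EFin.
  have ichi : gauss2.-integrable setT (EFin \o (fun z => C * mu k * chi_square z)).
    by apply: integrableZ_EFin; exact: integrable_chi_square.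
  apply: (@le_trans _ _ (\int[gauss2]_z (e * (1 + W w ^+ 2) + C * mu k * chi_square z))).
    apply: le_Rintegral => //.
    - rewrite (_ : EFin \o _ = (abse \o (EFin \o (fun z => g (W w) - g (W w + shift k z)))))//.
      by apply: integrable_abse; exact: integrableB_EFin.
    - by apply: integrableD_EFin => //; exact: finite_measure_integrable_cst.
    move=> z _; rewrite (le_trans (gmod _ _ _))//.
      by rewrite mulr_ge0// chi_square_ge0.
    by rewrite /shift mulrA.
  rewrite RintegralD//; last exact: finite_measure_integrable_cst.
  rewrite Rintegral_prob_cst RintegralZl//; last exact: integrable_chi_square.
  by rewrite chi_square_mean lerD2l; rewrite le_eqVlt; apply/orP; left; apply/eqP; ring.
rewrite RintegralD//; last 2 first.
- apply: integrableZ_EFin; apply: integrableD_EFin => //.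
  exact: finite_measure_integrable_cst.
- exact: finite_measure_integrable_cst.
rewrite Rintegral_prob_cst RintegralZl//; last first.
  by apply: integrableD_EFin => //; exact: finite_measure_integrable_cst.
rewrite RintegralD//; last exact: finite_measure_integrable_cst.
by rewrite Rintegral_prob_cst standardised_variance lerD2r le_eqVlt;
  apply/orP; left; apply/eqP; ring.
Qed.

(** Stein's equation turns the distance to the Gaussian mean [c] into
    [E (f' (W) - W f(W))]; the zero-bias identity writes this as an average,
    with weights [2 * mu k ^+ 2] of sum one, of increments of [f'] over the small
    shifts [mu k * chi]. *)
Lemma stein_bound (f f' h : R -> R) (B c e C : R) :
  (forall x : R, is_derive x 1 f (f' x)) -> continuous f' ->
  (forall x, `|f' x| <= B) -> (forall x, f' x = x * f x + (h x - c)) -> 0 <= C ->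
  (forall x v : R, 0 <= v -> `|f' x - f' (x + v)| <= e * (1 + x ^+ 2) + C * v) ->
  `|\int[P]_w h (W w) - c| <= 2 * e + 4 * C * \sum_(k < n) mu k ^+ 3.
Proof.
move=> df cf' f'B fE C0 f'mod.
have [iWf zb] := standardised_zero_bias df cf' f'B.
have mf' := continuous_measurable_fun cf'.
have if' : P.-integrable setT (EFin \o (fun w => f' (W w))).
  by apply: (@integrable_bounded _ _ _ P _ B) => //; exact: measurableT_comp.
have -> : \int[P]_w h (W w) - c =
    \sum_(k < n) 2 * mu k ^+ 2 * (\int[P]_w f' (W w) -
      \int[P]_w \int[gauss2]_z f' (W w + shift k z)).
  rewrite (eq_bigr _ (fun k _ => mulrBr _ _ _)) sumrB -zb -mulr_suml sum_weights mul1r.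
  rewrite -RintegralB//.
  have -> : \int[P]_w (f' (W w) - W w * f (W w)) = \int[P]_w (h (W w) - c).
    by apply: eq_Rintegral => w _; rewrite fE; ring.
  have -> : (fun w => h (W w) - c) = (fun w => f' (W w) - W w * f (W w)).
    by apply/funext => w; rewrite fE; ring.
  have hE : (fun w => h (W w)) = (fun w => (f' (W w) - W w * f (W w)) + c).
    by apply/funext => w; rewrite fE; ring.
  rewrite hE RintegralD//; last 2 first.
  - exact: integrableB_EFin.
  - exact: finite_measure_integrable_cst.
  by rewrite Rintegral_prob_cst addrK.
rewrite (le_trans (ler_norm_sum _ _ _))//.
rewrite (@le_trans _ _ (\sum_(k < n) 2 * mu k ^+ 2 * (2 * e + 2 * C * mu k)))//.
  apply: ler_sum => k _.
  have wk : 0 <= 2 * mu k ^+ 2 by apply: mulr_ge0 => //; exact: sqr_ge0.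
  rewrite normrM (ger0_norm wk); apply: ler_wpM2l => //.
  exact: (shift_bound k cf' f'B C0 f'mod).
have -> : \sum_(k < n) 2 * mu k ^+ 2 * (2 * e + 2 * C * mu k) =
    (\sum_(k < n) 2 * mu k ^+ 2) * (2 * e) + 4 * C * \sum_(k < n) mu k ^+ 3.
  rewrite mulr_suml mulr_sumr -big_split/=.
  by apply: eq_bigr => k _; ring.
by rewrite sum_weights mul1r.
Qed.

Let sum_mu3_le (eta : R) : 0 < eta ->
  \sum_(k < n) mu k ^+ 3 <= eta / 4 + (2 * eta)^-1 * \sum_(k < n) mu k ^+ 4.
Proof.
move=> eta0.
rewrite (@le_trans _ _ (\sum_(k < n) (eta / 2 * mu k ^+ 2 + (2 * eta)^-1 * mu k ^+ 4)))//.
  apply: ler_sum => k _.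
  rewrite -subr_ge0.
  have -> : eta / 2 * mu k ^+ 2 + (2 * eta)^-1 * mu k ^+ 4 - mu k ^+ 3 =
     (2 * eta)^-1 * mu k ^+ 2 * (eta - mu k) ^+ 2 by field; rewrite gt_eqF.
  apply: mulr_ge0; last exact: sqr_ge0.
  by apply: mulr_ge0; [rewrite invr_ge0 mulr_ge0// ltW|exact: sqr_ge0].
rewrite big_split/= -!mulr_sumr sum_mu2 lerD2r; rewrite le_eqVlt; apply/orP; left; apply/eqP.
by field.
Qed.

(** The third powers are traded for fourth powers by the inequality between
    arithmetic and geometric means. *)
Lemma stein_bound4 (f f' h : R -> R) (B c e C : R) : 0 < e ->
  (forall x : R, is_derive x 1 f (f' x)) -> continuous f' ->
  (forall x, `|f' x| <= B) -> (forall x, f' x = x * f x + (h x - c)) -> 0 <= C ->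
  (forall x v : R, 0 <= v -> `|f' x - f' (x + v)| <= e * (1 + x ^+ 2) + C * v) ->
  `|\int[P]_w h (W w) - c| <= 3 * e + 2 * C * (C + 1) / e * \sum_(k < n) mu k ^+ 4.
Proof.
move=> e0 df cf' f'B fE C0 f'mod.
rewrite (le_trans (stein_bound df cf' f'B fE C0 f'mod))//.
have C1 : 0 < C + 1 by rewrite ltr_wpDl.
(* The scale [e / (C + 1)] leaves an error [e] independent of [C]. *)
have eta0 : 0 < e / (C + 1) by rewrite divr_gt0.
have := ler_wpM2l (mulr_ge0 (ler0n R 4) C0) (sum_mu3_le eta0).
have -> : 4 * C * (e / (C + 1) / 4 + (2 * (e / (C + 1)))^-1 * \sum_(k < n) mu k ^+ 4) =
  C * (e / (C + 1)) + 2 * C * (C + 1) / e * \sum_(k < n) mu k ^+ 4.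
  by field; rewrite !gt_eqF.
have : C * (e / (C + 1)) <= e.
  by rewrite mulrCA ler_piMr ?(ltW e0)// ler_pdivrMr// mul1r lerDl.
lra.
Qed.

(** The Laplace transform at [1] is at most its Gaussian value [expR (1 / 2)],
    with a deficit measured by the fourth powers. *)
Lemma standardised_laplace : P.-integrable setT (EFin \o (fun w => expR (- W w))) /\
  \int[P]_w expR (- W w) <= expR (1 / 2 - 4 / 9 * \sum_(k < n) mu k ^+ 4).
Proof.
have WE : (fun w => expR (- W w)) = (fun w => expR (m / sigma) * expR (- (sigma^-1 * S w))).
  by apply/funext => w; rewrite -expRD /W; congr expR; ring.
have is_ge0 : 0 <= sigma^-1 by rewrite invr_ge0 ltW.
have iexp : P.-integrable setT (EFin \o (fun w => expR (- (sigma^-1 * S w)))).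
  apply: (@integrable_bounded _ _ _ P _ 1).
    apply: measurableT_comp => //; apply: measurableT_comp => //.
    by apply: measurable_funM => //; exact: (gl_measurable HS).
  move=> w; rewrite ger0_norm ?expR_ge0// expR_le1 oppr_le0 mulr_ge0//.
  exact: (gl_ge0 HS).
split; first by rewrite WE; exact: integrableZ_EFin.
rewrite WE RintegralZl// (gl_laplace HS)//.
have -> : m / sigma = \sum_(k < n) mu k by rewrite mulr_suml.
rewrite expR_sum -big_split/=.
have -> : 1 / 2 - 4 / 9 * \sum_(k < n) mu k ^+ 4 =
    \sum_(k < n) (mu k ^+ 2 - 4 / 9 * mu k ^+ 4).
  by rewrite sumrB -mulr_sumr sum_mu2.
rewrite expR_sum; apply: ler_prod => k _.
have mu1 : mu k <= 1.
  have : mu k ^+ 2 <= 1 / 2.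
    by rewrite -sum_mu2 (bigD1 k)//= lerDl sumr_ge0// => i _; exact: sqr_ge0.
  by have := mu_ge0 k; nra.
have muk := mu_ge0 k.
have -> : sigma^-1 * lam k = mu k by rewrite mulrC.
have p : 0 < 1 + 2 * mu k by lra.
rewrite mulr_ge0 ?expR_ge0 ?invr_ge0 ?sqrtr_ge0//=.
have mu43 : mu k ^+ 4 <= mu k ^+ 3 by rewrite exprS ler_piMl// exprn_ge0.
set X := _ - _; rewrite ler_pdivrMr ?sqrtr_gt0// mulrC -ler_pdivrMr ?expR_gt0//.
rewrite -expRB -(ger0_norm (expR_ge0 (mu k - X))) -sqrtr_sqr ler_wsqrtr//.
rewrite -expRM_natl (@le_trans _ _ (expR (2 * mu k - (2 * mu k) ^+ 2 / 2 + (2 * mu k) ^+ 3 / 9)))//.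
  by rewrite ler_expR /X; move: mu43; nra.
by apply: expR_cubic_le; apply/andP; split; lra.
Qed.

End standardised.

(** * The limit theorem *)

Section truncated_exponential.
Context (R : realType).
Local Notation gauss := (@normal_prob R 0 1).

(** Bounded continuous minorants of [expR (- x)]: tested on them, convergence
    in law bounds the exponential means from below. *)
Definition truncated_exp (K : nat) (x : R) : R := Num.min (expR (- x)) K%:R.

Lemma continuous_truncated_exp K : continuous (truncated_exp K).
Proof.
move=> x; apply: (@continuous_min _ _ (fun x => expR (- x)) (cst K%:R) x); last exact: cvg_cst.
apply: (@cvg_comp _ _ _ (fun x : R => - x) expR _ (nbhs (- x))).
  by apply: cvgN; exact: cvg_id.
exact: continuous_expR.
Qed.

Lemma truncated_exp_ge0 K x : 0 <= truncated_exp K x.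
Proof. by rewrite /truncated_exp le_min expR_ge0/=. Qed.

Lemma truncated_exp_le K x : truncated_exp K x <= expR (- x).
Proof. by rewrite ge_min lexx. Qed.

Lemma truncated_exp_bound K x : `|truncated_exp K x| <= K%:R.
Proof. by rewrite ger0_norm ?truncated_exp_ge0// ge_min lexx orbT. Qed.

Lemma truncated_exp_limit :
  \int[gauss]_x truncated_exp K x @[K --> \oo] --> expR (1 / 2).
Proof.
have [iexp E] := @normal_mgf R 0 1 (oner_neq0 _) (-1).
have {}E : \int[gauss]_x expR (- x) = expR (1 / 2).
  apply: etrans (etrans E _); last by congr expR; rewrite sqrrN !expr1n mulr1.
  by apply: eq_Rintegral => x _; rewrite subr0 mulN1r.
have {}iexp : gauss.-integrable setT (EFin \o (fun x => expR (- x))).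
  by move: iexp; under eq_fun do rewrite subr0 mulN1r.
rewrite -E; apply: (@Rdominated_cvg _ _ _ gauss _ _ (fun x => expR (- x))) => //.
- by move=> K; apply: continuous_measurable_fun; exact: continuous_truncated_exp.
- move=> x; apply: cvg_near_cst; near=> K.
  rewrite /truncated_exp min_l//; near: K; exact: nbhs_infty_ger.
- move=> K x; rewrite ger0_norm ?truncated_exp_ge0//; exact: truncated_exp_le.
Unshelve. all: by end_near. Qed.

End truncated_exponential.

Section limit_theorem.
Context d (T : measurableType d) (R : realType) (P : probability T R).
Variables (lam : forall n, 'I_n -> R) (S : nat -> T -> R).
Hypothesis HS : forall n, (0 < n)%N -> gamma_law P (@lam n) (S n).
Hypothesis lam_gt0 : forall n, (0 < n)%N -> 0 < \sum_(k < n) lam k ^+ 2.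

Local Notation gauss := (@normal_prob R 0 1).
Let sigma n := Num.sqrt (2 * \sum_(k < n) lam k ^+ 2).
Let W n w := (S n w - \sum_(k < n) lam k) / sigma n.
Let fourth n := \sum_(k < n) (lam k / sigma n) ^+ 4.

Let fourth_ge0 n : 0 <= fourth n.
Proof. by apply: sumr_ge0 => k _; rewrite exprn_even_ge0. Qed.

(** Stein's method: in [stein_bound4] the constants depend only on the test function
    and on the tolerance. *)
Lemma fourth_to_clt : fourth n @[n --> \oo] --> (0 : R) ->
  forall (h : R -> R) (M : R), continuous h -> (forall x, `|h x| <= M) ->
  \int[P]_w h (W n w) @[n --> \oo] --> \int[gauss]_x h x.
Proof.
move=> f0 h M ch hM.
have [f [f' [df cf' f'B fE]]] := stein_solution ch hM.
apply/cvgrPdist_le => e e0; have e4 : 0 < e / 4 by rewrite divr_gt0.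
have [C C0 f'mod] := continuous_bounded_modulus cf' f'B e4.
pose D := 2 * C * (C + 1) / (e / 4).
have D0 : 0 <= D.
  by rewrite divr_ge0 ?(ltW e4)// mulr_ge0 ?mulr_ge0// addr_ge0.
have D1 : 0 < D + 1 by rewrite ltr_wpDl.
have eD : 0 < e / 4 / (D + 1) by rewrite divr_gt0.
near=> n.
have n0 : (0 < n)%N by near: n; exact: nbhs_infty_gt.
have := stein_bound4 (HS n0) (lam_gt0 n0) e4 df cf' f'B fE C0 f'mod.
rewrite distrC -/(sigma n) -/(fourth n) -/D.
have small : `|0 - fourth n| <= e / 4 / (D + 1).
  by near: n; move/cvgrPdist_le : f0; exact.
have : D * fourth n <= e / 4.
  rewrite sub0r normrN ger0_norm// in small.
  rewrite (@le_trans _ _ ((D + 1) * fourth n))//.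
    by rewrite ler_wpM2r// lerDl.
  by rewrite mulrC -ler_pdivlMr.
rewrite /W; lra.
Unshelve. all: by end_near. Qed.

(** Convergence in law gives [liminf E expR (- W n) >= expR (1 / 2)], tested on
    truncations, while [standardised_laplace] bounds the same mean from above by
    [expR (1 / 2 - 4 / 9 * fourth n)]; so [fourth n] must vanish. *)
Lemma clt_to_fourth :
  (forall (h : R -> R) (M : R), continuous h -> (forall x, `|h x| <= M) ->
    \int[P]_w h (W n w) @[n --> \oo] --> \int[gauss]_x h x) ->
  fourth n @[n --> \oo] --> (0 : R).
Proof.
move=> clt; apply/cvgrPdist_le => e e0.
pose A : R := expR (1 / 2).
have A0 : 0 < A by exact: expR_gt0.
(* Chosen so that [(1 - eta) * (1 + z) <= 1] amounts to [z <= e / 3]. *)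
pose eta := e / (e + 3).
have e3 : 0 < e + 3 by rewrite addr_gt0.
have eta0 : 0 < eta by rewrite divr_gt0.
have Ae : 0 < A * eta / 2 by rewrite divr_gt0// mulr_gt0.
have /cvgrPdist_le/(_ _ Ae) [K _ /(_ K (leqnn K)) /= trK] := @truncated_exp_limit R.
have := clt _ _ (@continuous_truncated_exp R K) (@truncated_exp_bound R K).
move/cvgrPdist_le => /(_ _ Ae) cltK.
near=> n.
have n0 : (0 < n)%N by near: n; exact: nbhs_infty_gt.
have close : `|\int[gauss]_x truncated_exp K x - \int[P]_w truncated_exp K (W n w)| <= A * eta / 2.
  by near: n; exact: cltK.
have [iexp le] := standardised_laplace (HS n0) (lam_gt0 n0).
rewrite -/(sigma n) -/(fourth n) in le.
have trle : \int[P]_w truncated_exp K (W n w) <= expR (1 / 2 - 4 / 9 * fourth n).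
  apply: le_trans le; apply: le_Rintegral => //.
    apply: (@integrable_bounded _ _ _ P _ K%:R) => [|w]; last exact: truncated_exp_bound.
    apply: measurableT_comp.
      apply: continuous_measurable_fun; exact: continuous_truncated_exp.
    apply: measurable_funM => //; apply: measurable_funB => //.
    exact: (gl_measurable (HS n0)).
  by move=> w _; exact: truncated_exp_le.
rewrite sub0r normrN ger0_norm//.
have lowA : A - A * eta <= A * expR (- (4 / 9 * fourth n)).
  rewrite -expRD; apply: le_trans trle.
  move: trK close; rewrite -/A !ler_norml => /andP[_ t1] /andP[_ t2].
  by lra.
have z1 : 1 - eta <= expR (- (4 / 9 * fourth n)).
  by rewrite -(ler_pM2l A0) mulrBr mulr1.
have f0 := fourth_ge0 n.
set z := 4 / 9 * fourth n in z1.
have z0 : 0 <= z by rewrite mulr_ge0.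
have z2 : (1 - eta) * (1 + z) <= 1.
  rewrite -[leRHS](mulVf (lt0r_neq0 (expR_gt0 z))) -expRN.
  apply: ler_pM => //; last exact: expR_ge1Dx.
    by rewrite subr_ge0 ler_pdivrMr// mul1r lerDl.
  exact: addr_ge0.
have : z <= e / 3.
  have etaE : 1 - eta = 3 / (e + 3) by rewrite /eta; field; rewrite gt_eqF.
  move: z2; rewrite etaE mulrAC ler_pdivrMr// mul1r; lra.
rewrite /z; lra.
Unshelve. all: by end_near. Qed.

End limit_theorem.

(** * From Gaussian vectors to weighted sums of squares *)

Lemma normrM_le_quartic (R : realType) (a b : R) :
  `|a * b| <= 1 + (a ^+ 4 + b ^+ 4).
Proof.
have h1 := sqr_ge0 (a - b); have h2 := sqr_ge0 (a + b).
have h3 := sqr_ge0 (a ^+ 2 - 1); have h4 := sqr_ge0 (b ^+ 2 - 1).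
have -> : a ^+ 4 = (a ^+ 2) ^+ 2 by ring.
have -> : b ^+ 4 = (b ^+ 2) ^+ 2 by ring.
by rewrite ler_norml; apply/andP; split; nra.
Qed.

Lemma mulr_square_le_quartic (R : realType) (a b : R) :
  a ^+ 2 * b ^+ 2 <= a ^+ 4 + b ^+ 4.
Proof.
have h1 := sqr_ge0 (a ^+ 2 - b ^+ 2); have h2 := sqr_ge0 (a ^+ 2 + b ^+ 2).
have -> : a ^+ 4 = (a ^+ 2) ^+ 2 by ring.
have -> : b ^+ 4 = (b ^+ 2) ^+ 2 by ring.
by nra.
Qed.

Lemma normr_le_square (R : realType) (a : R) : `|a| <= 1 + a * a.
Proof. by rewrite ler_norml; apply/andP; split; nra. Qed.

Section gaussian_vector.
Context d (T : measurableType d) (R : realType) (P : probability T R).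

Lemma mfun_sumE n (F : 'I_n -> {RV P >-> R}) w :
  (\sum_(k < n) F k) w = \sum_(k < n) F k w.
Proof.
have := @big_morph _ _ (fun f : {RV P >-> R} => f w) 0 +%R 0 +%R.
by move=> ->.
Qed.

Variables (n : nat) (Y : 'I_n -> {RV P >-> R}).
Hypothesis hY : centred_gaussian Y.
Variable lam : 'I_n -> R.
Hypothesis hlam : eigenvalues (cov_matrix Y) lam.

Let G := cov_matrix Y.
Let S w := \sum_(k < n) Y k w ^+ 2.

Let mY k : measurable_fun setT (Y k). Proof. exact: measurable_funPT. Qed.

Let combination (u : 'I_n -> R) : {RV P >-> R} := \sum_(k < n) u k *: Y k.

Let combinationE u w : combination u w = \sum_(k < n) u k * Y k w.
Proof. by rewrite /combination mfun_sumE. Qed.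

Let iY4 k : P.-integrable setT (EFin \o (fun w => Y k w ^+ 4)).
Proof.
have Yk_span : lin_span Y (Y k).
  exists 1%N, (cst 1), (cst k).
  by rewrite big_ord1 /cst scale1r.
have [gY EY] := hY.
by have [v []] := centred_gaussian_moments (gY _ Yk_span) (EY k).
Qed.

Let iYY j k : P.-integrable setT (EFin \o (fun w => Y j w * Y k w)).
Proof.
apply: (@integrable_le _ _ _ P _ (fun w => 1 + (Y j w ^+ 4 + Y k w ^+ 4))).
- exact: measurable_funM.
- apply: integrableD_EFin; first exact: finite_measure_integrable_cst.
  exact: integrableD_EFin.
by move=> w; exact: normrM_le_quartic.
Qed.

Let iY k : P.-integrable setT (EFin \o Y k).
Proof.
apply: (@integrable_le _ _ _ P _ (fun w => 1 + Y k w * Y k w)) => //.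
  by apply: integrableD_EFin => //; exact: finite_measure_integrable_cst.
by move=> w; exact: normr_le_square.
Qed.

Let GE j k : G j k = \int[P]_w (Y j w * Y k w).
Proof. by rewrite mxE unlock. Qed.

Let combination_mean u : ('E_P[combination u] = 0)%E.
Proof.
have [_ EY] := hY.
have EY0 k : \int[P]_w Y k w = 0.
  by rewrite /Rintegral -[0]/(fine 0%E) -(EY k) unlock.
have ia k : P.-integrable setT (EFin \o (fun w => u k * Y k w)).
  by apply: integrableZ_EFin.
have [i1 E1] := integrable_sum_EFin (index_enum 'I_n) ia.
rewrite unlock.
have -> : (\int[P]_w (combination u w)%:E)%E = (\int[P]_w (\sum_(k < n) u k * Y k w)%:E)%E.
  by apply: eq_integral => w _; rewrite combinationE.
rewrite -[LHS]fineK; last exact: integrable_fin_num.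
rewrite -[fine _]/(\int[P]_w (\sum_(k < n) u k * Y k w)) E1 big1// => k _.
by rewrite RintegralZl// EY0 mulr0.
Qed.

Let combination_square u :
  \int[P]_w ((\sum_(k < n) u k * Y k w) ^+ 2) =
  \sum_(j < n) \sum_(k < n) u j * G j k * u k.
Proof.
transitivity (\int[P]_w (\sum_(j < n) \sum_(k < n) u j * u k * (Y j w * Y k w))).
  apply: eq_Rintegral => w _; rewrite expr2 mulr_suml; apply: eq_bigr => j _.
  by rewrite mulr_sumr; apply: eq_bigr => k _; ring.
have ijk j k : P.-integrable setT (EFin \o (fun w => u j * u k * (Y j w * Y k w))).
  exact: integrableZ_EFin.
have ij j := integrable_sum_EFin (index_enum 'I_n) (ijk j).
rewrite (proj2 (integrable_sum_EFin (index_enum 'I_n) (fun j => proj1 (ij j)))).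
apply: eq_bigr => j _; rewrite (proj2 (ij j)); apply: eq_bigr => k _.
by rewrite RintegralZl// GE; ring.
Qed.

Let combination_moments u : let v := \sum_(j < n) \sum_(k < n) u j * G j k * u k in
  0 <= v /\ \int[P]_w cos (\sum_(k < n) u k * Y k w) = expR (- (v / 2)).
Proof.
have span_u : lin_span Y (combination u) by exists n, u, id.
have [gY _] := hY.
have [v [v0 _ v2 vc]] := centred_gaussian_moments (gY _ span_u) (combination_mean u).
have vE : v = \sum_(j < n) \sum_(k < n) u j * G j k * u k.
  rewrite -combination_square -v2; apply: eq_Rintegral => w _.
  by rewrite combinationE.
split; rewrite -vE// -vc; apply: eq_Rintegral => w _.
by rewrite combinationE.
Qed.

Let Gsym : G^T = G.
Proof.
apply/matrixP => j k; rewrite mxE !GE; apply: eq_Rintegral => w _.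
by rewrite mulrC.
Qed.

Lemma gaussian_vector_diagonalisation : exists U : 'M[R]_n,
  U *m U^T = 1%:M /\ U *m cov_matrix Y *m U^T = diag_mx (\row_k lam k).
Proof. exact: symmetric_diagonalisation Gsym hlam. Qed.

Lemma integrable_gaussian_square k :
  P.-integrable setT (EFin \o (fun w => Y k w ^+ 2)).
Proof. by under eq_fun do rewrite expr2; exact: iYY. Qed.

(** The rotated vector [Z = U Y] has the same sum of squares as [Y], and its
    linear combinations have the quadratic form [sum_k a_k^2 lam_k] as
    variance.  Their cosine transforms feed [gaussian_quadratic_laplace]; an
    eigenvalue is non-negative because it is the variance of some [Z k]. *)
Lemma gaussian_vector_gamma_law : gamma_law P lam S.
Proof.
have [U [UU UG]] := gaussian_vector_diagonalisation.
have UTU : U^T *m U = 1%:M by exact: mulmx1C.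
pose Z k w := \sum_(j < n) U k j * Y j w.
have mZ k : measurable_fun setT (Z k).
  by apply: measurable_sum => j; exact: measurable_funM.
have quadE (a : 'I_n -> R) : \sum_(i < n) \sum_(j < n)
    (\sum_(k < n) a k * U k i) * G i j * (\sum_(k < n) a k * U k j) =
    \sum_(k < n) a k ^+ 2 * lam k.
  pose r : 'rV[R]_n := \row_k a k.
  transitivity ((r *m (U *m G *m U^T) *m r^T) 0 0).
    rewrite !mulmxA -(mulmxA _ U^T) -trmx_mul mxE exchange_big; apply: eq_bigr => j _.
    rewrite mxE mulr_suml; apply: eq_bigr => i _.
    rewrite [(r *m U) _ _]mxE [(r *m U)^T _ _]mxE [(r *m U) _ _]mxE.
    by congr (_ * _ * _); apply: eq_bigr => k _; rewrite mxE.
  rewrite UG mul_mx_diag mxE; apply: eq_bigr => k _; rewrite !mxE; ring.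
have lam0 k : 0 <= lam k.
  have [v0 _] := combination_moments (fun j => U k j).
  have := quadE (fun i => (i == k)%:R).
  have sumU j : \sum_(i < n) (i == k)%:R * U i j = U k j.
    rewrite (bigD1 k)//= eqxx mul1r big1 ?addr0// => i /negbTE ->.
    by rewrite mul0r.
  have -> : \sum_(i < n) (i == k)%:R ^+ 2 * lam i = lam k.
    rewrite (bigD1 k)//= eqxx expr1n mul1r big1 ?addr0// => i /negbTE ->.
    by rewrite expr0n mul0r.
  move=> <-; apply: le_trans v0 _; rewrite le_eqVlt; apply/orP; left; apply/eqP.
  by apply: eq_bigr => i _; apply: eq_bigr => j _; rewrite !sumU.
have cosZ (u : 'I_n -> R) : \int[P]_w cos (\sum_(k < n) u k * Z k w) =
    expR (- ((\sum_(k < n) u k ^+ 2 * lam k) / 2)).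
  have [_] := combination_moments (fun j => \sum_(k < n) u k * U k j).
  rewrite quadE => <-; apply: eq_Rintegral => w _; congr cos.
  under eq_bigr do rewrite mulr_sumr.
  rewrite exchange_big; apply: eq_bigr => j _; rewrite mulr_suml.
  by apply: eq_bigr => k _; ring.
have sumZ2 w : \sum_(k < n) Z k w ^+ 2 = S w.
  pose y : 'cV[R]_n := \col_j Y j w.
  have -> : \sum_(k < n) Z k w ^+ 2 = ((U *m y)^T *m (U *m y)) 0 0.
    rewrite mxE; apply: eq_bigr => k _; rewrite mxE mxE expr2.
    by congr (_ * _); apply: eq_bigr => j _; rewrite mxE.
  rewrite trmx_mul mulmxA -(mulmxA y^T) UTU mulmx1 mxE.
  by apply: eq_bigr => k _; rewrite !mxE expr2.
have mS : measurable_fun setT S.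
  by apply: measurable_sum => k; exact: measurable_funX.
split => //.
- by move=> w; apply: sumr_ge0 => k _; exact: sqr_ge0.
- have -> : (fun w => S w ^+ 2) = (fun w => \sum_(j < n) \sum_(k < n) (Y j w ^+ 2 * Y k w ^+ 2)).
    apply/funext => w; rewrite expr2 mulr_suml; apply: eq_bigr => j _.
    by rewrite mulr_sumr.
  apply: (proj1 (integrable_sum_EFin _ _)) => j.
  apply: (proj1 (integrable_sum_EFin _ _)) => k.
  apply: (@integrable_le _ _ _ P _ (fun w => Y j w ^+ 4 + Y k w ^+ 4)).
  + by apply: measurable_funM; exact: measurable_funX.
  + exact: integrableD_EFin.
  move=> w; rewrite ger0_norm; last by apply: mulr_ge0; exact: sqr_ge0.
  exact: mulr_square_le_quartic.
- have [trE _ _] := mxtrace_diagonalised UU UG.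
  rewrite -trE /S (proj2 (integrable_sum_EFin _ (fun k => _))); last first.
    exact: integrable_gaussian_square.
  by apply: eq_bigr => k _; rewrite GE; apply: eq_Rintegral => w _; rewrite expr2.
- move=> t t0; rewrite -(gaussian_quadratic_laplace mZ lam0 t0 cosZ).
  by apply: eq_Rintegral => w _; rewrite sumZ2.
Qed.

End gaussian_vector.

Lemma quad_varE d (T : measurableType d) (R : realType) (P : probability T R)
    (n : nat) (Y : 'I_n -> {RV P >-> R}) (lam : 'I_n -> R)
    (hY : centred_gaussian Y) (hlam : eigenvalues (cov_matrix Y) lam) w :
  quad_var Y w = \sum_(k < n) Y k w ^+ 2 - \sum_(k < n) lam k.
Proof.
rewrite /quad_var (@mfun_sumE _ _ _ P).
rewrite -(gl_mean (gaussian_vector_gamma_law hY hlam)).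
rewrite (proj2 (integrable_sum_EFin (index_enum 'I_n) (integrable_gaussian_square hY))).
rewrite -sumrB; apply: eq_bigr => k _ /=.
by rewrite unlock.
Qed.

Section normalised_variance.
Context d (T : measurableType d) (R : realType) (P : probability T R).
Variables (n : nat) (Y : 'I_n -> {RV P >-> R}) (lam : 'I_n -> R).
Hypotheses (hY : centred_gaussian Y) (hlam : eigenvalues (cov_matrix Y) lam).

Let law := gaussian_vector_gamma_law hY hlam.
Let S w := \sum_(k < n) Y k w ^+ 2.
Let m := \sum_(k < n) lam k.

Lemma variance_quad_var :
  ('V_P[quad_var Y] = (2 * \sum_(k < n) lam k ^+ 2)%:E)%E.
Proof.
have iS := integrable_S (gl_measurable law) (gl_ge0 law) (gl_integrable2 law).
have iSm : P.-integrable setT (EFin \o (fun w => S w - m)).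
  by apply: integrableB_EFin => //; exact: finite_measure_integrable_cst.
have V := gamma_variance (gl_lam_ge0 law) (gl_measurable law) (gl_ge0 law)
  (gl_integrable2 law) (gl_mean law) (gl_laplace law) (@measurable_chi_square R)
  (@chi_square_ge0 R) (@chi_square_laplace R).
have i2 : P.-integrable setT (EFin \o (fun w => (S w - m) ^+ 2)).
  have -> : (fun w => (S w - m) ^+ 2) = (fun w => S w ^+ 2 + (- 2 * m * S w + m ^+ 2)).
    by apply/funext => w; ring.
  apply: integrableD_EFin; first exact: (gl_integrable2 law).
  apply: integrableD_EFin; first exact: integrableZ_EFin.
  exact: finite_measure_integrable_cst.
have E0 : fine 'E_P[quad_var Y]%E = 0.
  rewrite unlock -[LHS]/(\int[P]_w quad_var Y w).
  under eq_Rintegral do rewrite (quad_varE hY hlam).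
  rewrite RintegralB//; last exact: finite_measure_integrable_cst.
  by rewrite (gl_mean law) Rintegral_prob_cst subrr.
rewrite -V /variance covariance.unlock E0 expectation.unlock.
rewrite -[RHS]/((fine (\int[P]_w ((S w - m) ^+ 2)%:E))%:E)%E fineK; last exact: integrable_fin_num.
apply: eq_integral => w _.
rewrite -[LHS]/(((quad_var Y w - 0) * (quad_var Y w - 0))%:E).
by rewrite (quad_varE hY hlam) subr0 expr2.
Qed.

Lemma normalised_quad_varE w : normalised (quad_var Y) w =
  (S w - m) / Num.sqrt (2 * \sum_(k < n) lam k ^+ 2).
Proof.
rewrite -[LHS]/((Num.sqrt (fine 'V_P[quad_var Y]%E))^-1 * quad_var Y w).
by rewrite variance_quad_var (quad_varE hY hlam) mulrC.
Qed.

End normalised_variance.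

(** * The equivalences *)

Lemma bounded_fun_realP (R : realType) (f : R -> R) :
  bounded_fun (f : R -> R^o) <-> exists M : R, forall x, `|f x| <= M.
Proof.
split=> [[M [_ fM]]|[M fM]].
  exists (M + 1) => x.
  by apply: (fM (M + 1)) => //; rewrite ltrDl.
by exists M; split; [exact: num_real|move=> N MN x _; exact: le_trans (fM x) (ltW MN)].
Qed.

(** Convergence of expectations in the extended reals reduces to real integrals.
    The index [0] is left aside, since the sequence is only controlled from
    [n = 1] on. *)
Lemma cvg_in_distribution_realP d (T : measurableType d) (R : realType)
    (P : probability T R) (Z : nat -> {RV P >-> R}) (W : nat -> T -> R)
    (mu : probability (measurableTypeR R) R) :
  (forall n, (0 < n)%N -> forall w, Z n w = W n w) ->
  cvg_in_distribution Z mu <->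
  (forall (h : R -> R) (M : R), continuous h -> (forall x, `|h x| <= M) ->
    \int[P]_w h (W n w) @[n --> \oo] --> \int[mu]_x h x).
Proof.
move=> ZW.
have EZ (h : R -> R) (M : R) n : continuous h -> (forall x, `|h x| <= M) -> (0 < n)%N ->
    ('E_P[h \o Z n] = (\int[P]_w h (W n w))%:E)%E.
  move=> ch hM n0; rewrite unlock.
  have -> : \int[P]_w h (W n w) = \int[P]_w (h \o Z n) w.
    by apply: eq_Rintegral => w _; rewrite /= ZW.
  rewrite fineK//; apply: integrable_fin_num => //.
  apply: (@integrable_bounded _ _ _ P _ M) => [|w]; last exact: hM.
  by apply: measurableT_comp => //; exact: continuous_measurable_fun.
have Emu (h : R -> R) (M : R) : continuous h -> (forall x, `|h x| <= M) ->
    (\int[mu]_x (h x)%:E = (\int[mu]_x h x)%:E)%E.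
  move=> ch hM; rewrite fineK//; apply: integrable_fin_num => //.
  apply: (@integrable_bounded _ _ _ mu _ M) => //.
  exact: continuous_measurable_fun.
split=> [clt h M ch hM|clt h ch /bounded_fun_realP[M hM]].
  have /fine_cvgP[_] : ('E_P[h \o Z n] @[n --> \oo] --> (\int[mu]_x h x)%:E)%E.
    rewrite -(Emu h M)//; apply: clt => //; apply/bounded_fun_realP; by exists M.
  apply: cvg_trans; apply: near_eq_cvg; near=> n.
  by rewrite /= (EZ h M)//; near: n; exact: nbhs_infty_gt.
rewrite (Emu h M)//; apply/fine_cvgP; split.
  by near=> n; rewrite (EZ h M)//; near: n; exact: nbhs_infty_gt.
apply: cvg_trans (clt h M ch hM); apply: near_eq_cvg; near=> n.
by rewrite /= (EZ h M)//; near: n; exact: nbhs_infty_gt.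
Unshelve. all: by end_near. Qed.

Lemma littleo_cvg0P (R : realType) (a b s : nat -> R) (c : R) : c != 0 ->
  (forall n, (0 < n)%N -> `|a n| / `|b n| = c * s n) ->
  is_littleo a b <-> s n @[n --> \oo] --> (0 : R).
Proof.
move=> c0 ab; split=> h.
- have : c^-1 * (`|a n| / `|b n|) @[n --> \oo] --> c^-1 * (0 : R).
    by apply: cvgM; [exact: cvg_cst|exact: h].
  rewrite mulr0; apply: cvg_trans; apply: near_eq_cvg; near=> n.
  by rewrite ab ?mulKf//; near: n; exact: nbhs_infty_gt.
- have : c * s n @[n --> \oo] --> c * (0 : R).
    by apply: cvgM; [exact: cvg_cst|exact: h].
  rewrite mulr0; apply: cvg_trans; apply: near_eq_cvg; near=> n.
  by rewrite ab//; near: n; exact: nbhs_infty_gt.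
Unshelve. all: by end_near. Qed.

Theorem theorem2p7 (d : measure_display) (T : measurableType d) (R : realType)
  (P : probability T R) (I : Type) (X : I -> {RV P >-> R})
  (hX : centred_gaussian X) (sepX : separable_process X)
  (Y : forall n : nat, 'I_n -> {RV P >-> R})
  (hY : forall n, (0 < n)%N -> centred_gaussian (@Y n))
  (chaosY : forall n, (0 < n)%N -> forall k : 'I_n, first_chaos X (Y n k))
  (lambda : forall n : nat, 'I_n -> R)
  (hlambda : forall n, (0 < n)%N ->
     eigenvalues (cov_matrix (@Y n)) (@lambda n))
  (hvar : forall n, (0 < n)%N -> (0 < 'V_P[quad_var (@Y n)])%E) :
  let V n := quad_var (@Y n) in
  let VarV n : R := fine 'V_P[V n]%E in
  let G n (j k : 'I_n) : R := fine 'E_P[Y n j \* Y n k]%E in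
  let clt := cvg_in_distribution (fun n => normalised (V n))
               (@normal_prob R 0 1) in
  let cumulant := is_littleo
    (fun n => \sum_(i < n) \sum_(j < n) \sum_(k < n) \sum_(l < n)
                G n k j * G n j i * G n i l * G n l k)
    (fun n => VarV n ^+ 2) in
  let spectral := is_littleo
    (fun n => \sum_(k < n) lambda n k ^+ 4)
    (fun n => (\sum_(k < n) lambda n k ^+ 2) ^+ 2) in
  (clt <-> cumulant) /\ (cumulant <-> spectral).
Proof.
move=> V VarV G clt cumulant spectral.
pose q n : R := \sum_(k < n) lambda n k ^+ 2.
pose r n : R := \sum_(k < n) lambda n k ^+ 4.
pose s n : R := \sum_(k < n) (lambda n k / Num.sqrt (2 * q n)) ^+ 4.
have VarE n : (0 < n)%N -> ('V_P[V n] = (2 * q n)%:E)%E.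
  by move=> n0; exact: (variance_quad_var (hY _ n0) (hlambda _ n0)).
have VarVE n : (0 < n)%N -> VarV n = 2 * q n by move=> n0; rewrite /VarV VarE.
have q_gt0 n : (0 < n)%N -> 0 < q n.
  by move=> n0; have := hvar _ n0; rewrite -/(V n) VarE// lte_fin pmulr_rgt0.
have r_ge0 n : 0 <= r n by apply: sumr_ge0 => k _; rewrite exprn_even_ge0.
have sE n : (0 < n)%N -> s n = r n / (4 * q n ^+ 2).
  move=> n0; have q0 := q_gt0 _ n0; rewrite /s /r mulr_suml; apply: eq_bigr => k _.
  rewrite exprMn exprVn; congr (_ / _).
  rewrite (_ : _ ^+ 4 = (Num.sqrt (2 * q n) ^+ 2) ^+ 2); last by ring.
  by rewrite sqr_sqrtr; [ring|rewrite mulr_ge0// ltW].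
have cumulantE : cumulant <-> s n @[n --> \oo] --> (0 : R).
  apply: (@littleo_cvg0P _ _ _ _ 1 (oner_neq0 _)) => n n0.
  have [U [UU UG]] := gaussian_vector_diagonalisation (hlambda _ n0).
  have [_ _ tr4] := mxtrace_diagonalised UU UG.
  rewrite (_ : \sum_(i < n) _ = r n); last first.
    rewrite /r -tr4 -mxtrace_fourth_entries.
    apply: eq_bigr => i _; apply: eq_bigr => j _; apply: eq_bigr => k _.
    by apply: eq_bigr => l _; rewrite !mxE.
  rewrite VarVE// sE// mul1r ger0_norm// ger0_norm ?sqr_ge0//.
  by congr (_ / _); ring.
have spectralE : spectral <-> s n @[n --> \oo] --> (0 : R).
  apply: (@littleo_cvg0P _ _ _ _ 4) => // n n0.
  rewrite sE// -/(r n) -/(q n) ger0_norm// ger0_norm ?sqr_ge0//.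
  by field; rewrite gt_eqF// q_gt0.
have law n (n0 : (0 < n)%N) := gaussian_vector_gamma_law (hY _ n0) (hlambda _ n0).
have cltE := @cvg_in_distribution_realP _ _ _ P (fun n => normalised (V n))
  (fun n w => (\sum_(k < n) Y n k w ^+ 2 - \sum_(k < n) lambda n k) / Num.sqrt (2 * q n))
  (@normal_prob R 0 1)
  (fun n n0 => normalised_quad_varE (hY _ n0) (hlambda _ n0)).
split; last first.
  by split=> [/cumulantE/spectralE|/spectralE/cumulantE].
split=> [/cltE|/cumulantE s0].
  by move=> /(clt_to_fourth law q_gt0) s0; apply/cumulantE.
by apply/cltE; exact: (fourth_to_clt law q_gt0 s0).
Qed.
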